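(* Let $f$ and $g$ be non-negative measurable functions defined on $\mathbb{R}^n$. Let $p \in \mathbb{R}$ and $q \in \mathbb{R}\cup\{+\infty\}$, and let $\ell=\ell(p,q)$ be the exponent defined in the context. Assume that the following conditions are satisfied: (i) $f$ is strictly $p$-concave on $\mathbb{R}^n$. (ii) $g$ is $q$-concave on $\mathbb{R}^n$. (iii) $\mathbb{R}^n\setminus g^{-1}(0)$ is bounded, and its interior is not empty. (iv) $p+q\geq 0$ and $\ell \geq -1/n$. Then the function $$G(x) = f*g(x) = \int_{\mathbb{R}^n} f(x-y)\,g(y)\,\mathrm{d}y,\quad x\in\mathbb{R}^n,$$ is strictly $\ell/(1+n\ell)$-concave on $\mathbb{R}^n$.
   Context: Means. For $a,b \in [0,+\infty)$, $\lambda \in [0,1]$ and $p \in \mathbb{R} \cup \{\pm\infty\}$, put $M_p(a,b;\lambda) = 0$ if $ab=0$; and, if $ab>0$, $M_p(a,b;\lambda) = ((1-\lambda)a^p + \lambda b^p)^{1/p}$ for $p \in \mathbb{R}\setminus\{0\}$, $M_0(a,b;\lambda) = a^{1-\lambda}b^\lambda$, $M_{+\infty}(a,b;\lambda) = \max\{a,b\}$, $M_{-\infty}(a,b;\lambda) = \min\{a,b\}$. Write $x_\lambda = (1-\lambda)x_0 + \lambda x_1$. Power concavity. A non-negative function $f$ on a convex set $A \subset \mathbb{R}^n$ is $p$-concave on $A$ if $f(x_\lambda) \geq M_p(f(x_0),f(x_1);\lambda)$ for all $x_0,x_1 \in A$ and $\lambda \in [0,1]$. It is strictly $p$-concave if moreover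 equality holds in this inequality if and only if $x_0=x_1$ or $\lambda=0$ or $\lambda=1$. Exponent. $\ell = \frac{pq}{p+q}$ if $p+q\neq 0$; $\ell=-\infty$ if $p+q=0$ and $(p,q)\neq(0,0)$; $\ell=0$ if $(p,q)=(0,0)$. For $q=+\infty$ and $p\in\mathbb{R}$, $\frac{pq}{p+q}$ is understood as $p$. The exponent $\ell/(1+n\ell)$ is understood as $-\infty$ when $\ell=-1/n$.
   Formalization: When the exponent is infinite (the case ℓ = -1/n), the equality condition in strict concavity is required only for 0 < λ < 1, since at λ = 0 or 1 the minimum need not equal the endpoint value and the literal condition is unsatisfiable. *)

(* Defs.v *)
From HB Require Import structures.
From mathcomp Require Import all_boot all_order all_algebra.
From mathcomp Require Import all_classical all_reals all_analysis.

Set Implicit Arguments.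
Unset Strict Implicit.
Unset Printing Implicit Defensive.

Import Order.TTheory GRing.Theory Num.Theory.
Import numFieldNormedType.Exports.

Local Open Scope classical_set_scope.
Local Open Scope ring_scope.

Section lebesgue_rV.
Variables (R : realType) (n : nat).
Implicit Types p : 'rV[R]_n * 'rV[R]_n.

Definition box p : set 'rV[R]_n :=
  [set x | forall i, p.1 0 i < x 0 i <= p.2 0 i].

Definition box_volume p : R := \prod_(i < n) Num.max 0 (p.2 0 i - p.1 0 i).

(* Infimum of the total volume of the countable families of boxes covering A.
   The families are sets of (lower corner, upper corner) pairs, so they may be
   finite or empty. *)
Definition lebesgue_outer (A : set 'rV[R]_n) : \bar R :=
  ereal_inf [set (\esum_(p in S) (box_volume p)%:E)%E |
             S in [set S | countable S /\ A `<=` \bigcup_(p in S) box p]].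

Local Open Scope ereal_scope.

Let box_volume_ge0 p : 0 <= (box_volume p)%:E.
Proof.
by rewrite lee_fin; apply: prodr_ge0 => i _; rewrite le_max lexx.
Qed.

Let lebesgue_outer_ge0 A : 0 <= lebesgue_outer A.
Proof. by apply: le_ereal_inf_tmp => _ [S _ <-]; exact: esum_ge0. Qed.

Let lebesgue_outer0 : lebesgue_outer set0 = 0.
Proof.
apply/eqP; rewrite eq_le lebesgue_outer_ge0 andbT.
apply: ereal_inf_lbound; exists set0; last by rewrite esum_set0.
by split; [exact: countable0|exact: sub0set].
Qed.

Let le_lebesgue_outer : {homo lebesgue_outer : A B / A `<=` B >-> A <= B}.
Proof.
move=> A B AB; apply: ereal_inf_le_tmp => _ [S [cS BS] <-].
by exists S => //; split=> //; exact: subset_trans BS.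
Qed.

Let lebesgue_outer_sigma_subadditive : sigma_subadditive lebesgue_outer.
Proof.
move=> A; have [[i ioo]|] := pselect (exists i, lebesgue_outer (A i) = +oo).
  by rewrite (eseries_pinfty _ _ ioo) ?leey// => k _; rewrite -ltNye
    (lt_le_trans _ (lebesgue_outer_ge0 _)).
rewrite -forallNE => Aoo; apply/lee_addgt0Pr => e e0.
apply: le_trans (epsilon_trick _ _ (ltW e0)) => //.
have [S PS] : {S : (set ('rV[R]_n * 'rV[R]_n))^nat & forall k,
    [/\ countable (S k), A k `<=` \bigcup_(p in S k) box p &
      \esum_(p in S k) (box_volume p)%:E <=
      lebesgue_outer (A k) + (e / (2 ^ k.+1)%:R)%:E]}.
  apply: (@choice _ _ (fun k S => [/\ countable S,
    A k `<=` \bigcup_(p in S) box p & \esum_(p in S) (box_volume p)%:E <=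
      lebesgue_outer (A k) + (e / (2 ^ k.+1)%:R)%:E])) => k.
  have ek0 : (0 < e / (2 ^ k.+1)%:R)%R by rewrite divr_gt0// ltr0n expn_gt0.
  have Afin : lebesgue_outer (A k) \is a fin_num.
    by rewrite ge0_fin_numE// ltey; apply/eqP/Aoo.
  have [_ [S [cS AS] <-] /ltW SA] := lb_ereal_inf_adherent ek0 Afin.
  by exists S.
apply: (@le_trans _ _ (\esum_(p in \bigcup_k S k) (box_volume p)%:E)).
  apply: ereal_inf_lbound; exists (\bigcup_k S k) => //; split.
    by apply: bigcup_countable => // k _; have [] := PS k.
  move=> x [k _]; have [_ + _] := PS k => /[apply] -[p Sp xp].
  by exists p => //; exists k.
rewrite (seqDU_bigcup_eq S) esum_bigcupT//.
rewrite nneseries_esumT; last first.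
  by move=> k; rewrite adde_ge0// lee_fin divr_ge0 ?(ltW e0).
apply: le_esum => k _; have [_ _] := PS k; apply: le_trans.
rewrite esum_mkcond [leRHS]esum_mkcond; apply: le_esum => p _.
case: ifPn => [|_]; last by case: ifPn.
by rewrite inE => /(@subset_seqDU _ S) /mem_set ->.
Qed.

HB.instance Definition _ := isOuterMeasure.Build R 'rV[R]_n lebesgue_outer
  lebesgue_outer0 lebesgue_outer_ge0 le_lebesgue_outer
  lebesgue_outer_sigma_subadditive.

End lebesgue_rV.

Arguments lebesgue_outer R n : clear implicits.

(* 'rV[R]_n with the sigma-algebra of Lebesgue measurable sets, i.e., the sets
   satisfying Caratheodory's criterion for the Lebesgue outer measure. *)
Definition lebesgue_rV (R : realType) (n : nat) :=
  caratheodory_type (lebesgue_outer R n).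

HB.instance Definition _ (R : realType) (n : nat) :=
  Measurable.on (lebesgue_rV R n).

Definition lebesgue_measure_rV (R : realType) (n : nat) :
  set (lebesgue_rV R n) -> \bar R := lebesgue_outer R n.

HB.instance Definition _ (R : realType) (n : nat) :=
  isMeasure.Build _ _ _ (@lebesgue_measure_rV R n)
    (@caratheodory_measure0 _ _ (lebesgue_outer R n))
    (@caratheodory_measure_ge0 _ _ (lebesgue_outer R n))
    (@caratheodory_measure_sigma_additive _ _ (lebesgue_outer R n)).

Arguments lebesgue_measure_rV R n : clear implicits.

Definition lebesgue_measurable_fun (R : realType) (n : nat)
    (f : 'rV[R]_n -> R) : Prop :=
  measurable_fun [set: lebesgue_rV R n] f.

(* A divergent integral would yield 0. *)
Definition convolution (R : realType) (n : nat) (f g : 'rV[R]_n -> R)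
    (x : 'rV[R]_n) : R :=
  (\int[lebesgue_measure_rV R n]_y (f (x - (y : 'rV[R]_n)) * g y))%R.

Section power_concavity.
Variable R : realType.

Definition power_mean (p : \bar R) (a b t : R) : R :=
  if a * b == 0 then 0 else
  match p with
  | EFin r => if r == 0 then a `^ (1 - t) * b `^ t
              else ((1 - t) * a `^ r + t * b `^ r) `^ r^-1
  | EPInf => Num.max a b
  | ENInf => Num.min a b
  end.

Definition power_concave n (p : \bar R) (f : 'rV[R]_n -> R) : Prop :=
  (forall x, 0 <= f x) /\
  forall x0 x1 (t : R), 0 <= t <= 1 ->
    power_mean p (f x0) (f x1) t <= f ((1 - t) *: x0 + t *: x1).

(* For infinite p the equality case is only considered for 0 < t < 1: at t = 0
   and t = 1 the max and the min do not reduce to f x0 and f x1, so demanding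
   equality there would only leave constant functions. *)
Definition strictly_power_concave n (p : \bar R) (f : 'rV[R]_n -> R) : Prop :=
  power_concave p f /\
  forall x0 x1 (t : R), 0 <= t <= 1 -> p \is a fin_num \/ 0 < t < 1 ->
    (f ((1 - t) *: x0 + t *: x1) = power_mean p (f x0) (f x1) t <->
     [\/ x0 = x1, t = 0 | t = 1]).

(* The value at q = -oo is irrelevant. *)
Definition harmonic_exponent (p : R) (q : \bar R) : \bar R :=
  match q with
  | EFin s => if p + s == 0 then (if (p == 0) && (s == 0) then 0%E else -oo%E)
              else (p * s / (p + s))%:E
  | EPInf => p%:E
  | ENInf => -oo%E
  end.

(* l / (1 + n l), understood as -oo at l = -1/n and by its limit 1/n at
   infinite l. *)
Definition convolution_exponent (n : nat) (l : \bar R) : \bar R :=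
  match l with
  | EFin r => if r == - n%:R^-1 then -oo%E else (r / (1 + n%:R * r))%:E
  | _ => (n%:R^-1)%:E
  end.

End power_concavity.

(* Main.v *)
(* Strictness forces f > 0 and p <= 0, hence q >= 0 and -1/n <= l <= 0.  Write
   u_x(y) = f(x - y) g(y), so that f*g(x) is the integral of u_x, and fix
   x0 <> x1 and 0 < t < 1.  Hoelder's inequality for power means turns the
   concavity of f and g into the hypothesis of the Borell-Brascamp-Lieb
   inequality for the triple u_x0, u_x1, u_(x_t).

   That inequality is proved as Hadwiger and Ohmann prove Brunn-Minkowski: u_x0
   and u_x1 are approximated from below by step functions over boxes, which are
   cut by parallel hyperplanes in the same mass proportion until one box is left
   on either side; there the inequality is an inequality between power means,
   and the two sides of a cut add up because power means are homogeneous.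

   For strictness, choose a coordinate i in which x0 and x1 differ and cut off
   first a common small proportion of the masses at the left end of the support
   of g in direction i.  There y1 - y0 stays away from x1 - x0, so x0 - y0 and
   x1 - y1 stay apart, and by compactness the strict concavity of f gains a
   factor > 1 on that proportion of the integral. *)

Require Import Defs.
From HB Require Import structures.
From mathcomp Require Import all_boot all_order all_algebra.
From mathcomp Require Import all_classical all_reals all_analysis.
From mathcomp Require Import measurable_realfun ring lra.

Set Implicit Arguments.
Unset Strict Implicit.
Unset Printing Implicit Defensive.

Import Order.TTheory GRing.Theory Num.Theory.
Import numFieldNormedType.Exports.

Local Open Scope classical_set_scope.
Local Open Scope ring_scope.

(** * Power means *)

Section power_means.
Variable R : realType.
Implicit Types a b c d t p q l r x y : R.

(** Only a lower bound for the integral of u_(x_t) is wanted, so it is enough to approximate u_x0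
    and u_x1 from below; but passing to the limit would lose strictness. The gain is therefore kept
    quantitative. The proportion [theta] and the gap factor [k] are fixed before any step function
    is chosen and give a factor [w = 1 - theta + theta * k > 1]. The step functions then only have
    to catch a proportion [kappa] of each mass with [w * kappa > 1].

    All regularity comes from convexity. Since q >= 0, [- ln g] is convex on the support of g; hence
    g is bounded, and it is continuous in the interior of the support, where grids approximate u_x.
    On the boundary of the support nothing is known about continuity, but a bounded convex set with
    an interior point has a null boundary. *)

Lemma powR_expR x r : expR x `^ r = expR (r * x).
Proof. by rewrite /powR gt_eqF ?expR_gt0// expRK. Qed.

(** The tangent to the exponential at the mean [m] lies below the graph; the two tangent
    inequalities are averaged. *)
Lemma expR_convex t x y : 0 <= t <= 1 ->
  expR ((1 - t) * x + t * y) <= (1 - t) * expR x + t * expR y.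
Proof.
move=> /andP[t0 t1]; set m := (1 - t) * x + t * y.
have E z : expR z = expR m * expR (z - m) by rewrite -expRD addrC subrK.
rewrite (E x) (E y).
have := expR_ge1Dx (x - m); have := expR_ge1Dx (y - m); have := expR_gt0 m.
set u := expR (x - m); set v := expR (y - m); set w := expR m => w0 hv hu.
have H : 1 <= (1 - t) * u + t * v.
  have h1 : (1 - t) * (1 + (x - m)) <= (1 - t) * u by rewrite ler_wpM2l// subr_ge0.
  have h2 : t * (1 + (y - m)) <= t * v by rewrite ler_wpM2l.
  apply: le_trans (lerD h1 h2); rewrite /m; lra.
have := ler_wpM2l (ltW w0) H; lra.
Qed.

Lemma weighted_AMGM t a b : 0 <= t <= 1 -> 0 < a -> 0 < b ->
  a `^ (1 - t) * b `^ t <= (1 - t) * a + t * b.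
Proof.
move=> t01 a0 b0; rewrite -(lnK a0) -(lnK b0) !powR_expR -expRD.
exact: expR_convex.
Qed.

Lemma le0_ler_powR r a b : r <= 0 -> 0 < a -> a <= b -> b `^ r <= a `^ r.
Proof.
move=> r0 a0 ab; have b0 := lt_le_trans a0 ab.
rewrite -[r]opprK 2!(powRN _ (- r)) lef_pV2 ?posrE ?powR_gt0//.
by apply: ge0_ler_powR; rewrite ?nnegrE ?oppr_ge0 ?(ltW a0) ?(ltW b0).
Qed.

Lemma powRVK r a : r != 0 -> 0 <= a -> (a `^ r) `^ r^-1 = a.
Proof. by move=> r0 a0; rewrite -powRrM divff// powRr1. Qed.

Lemma powRKV r a : r != 0 -> 0 <= a -> (a `^ r^-1) `^ r = a.
Proof. by move=> r0 a0; rewrite -powRrM mulVf// powRr1. Qed.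

Lemma wsum_gt0 t a b : 0 <= t <= 1 -> 0 < a -> 0 < b ->
  0 < (1 - t) * a + t * b.
Proof.
move=> t01 a0 b0; apply: lt_le_trans (weighted_AMGM t01 a0 b0).
by rewrite mulr_gt0// powR_gt0.
Qed.

Lemma wsum_le t a b a' b' : 0 <= t <= 1 -> a <= a' -> b <= b' ->
  (1 - t) * a + t * b <= (1 - t) * a' + t * b'.
Proof. by move=> /andP[t0 t1] aa bb; rewrite lerD// ler_wpM2l// subr_ge0. Qed.

(* Locked, because the unifier, when it fails to identify two means by their
   arguments, unfolds them and does not return in reasonable time. *)
Fact pmean_key : unit. Proof. by []. Qed.
Definition pmean := locked_with pmean_key (@power_mean R).

Lemma pmeanE e a b t : pmean e a b t = power_mean e a b t.
Proof. by rewrite /pmean unlock. Qed.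

Lemma pmean_pos (e : \bar R) a b t : 0 < a -> 0 < b ->
  pmean e a b t = match e with
  | EFin r => if r == 0 then a `^ (1 - t) * b `^ t
              else ((1 - t) * a `^ r + t * b `^ r) `^ r^-1
  | EPInf => Num.max a b
  | ENInf => Num.min a b
  end.
Proof.
move=> a0 b0; rewrite /pmean unlock /power_mean gt_eqF//.
by rewrite mulr_gt0.
Qed.

Lemma pmean_gt0 e a b t : 0 < a -> 0 < b -> 0 <= t <= 1 ->
  0 < pmean e a b t.
Proof.
move=> a0 b0 t01; rewrite pmean_pos//; case: e => [r| |].
- case: ifPn => _; first by rewrite mulr_gt0// powR_gt0.
  by apply: powR_gt0; rewrite wsum_gt0// powR_gt0.
- by rewrite lt_max a0.
- by rewrite lt_min a0.
Qed.

Lemma pmeanZ e k a b t : 0 < k -> 0 < a -> 0 < b -> 0 <= t <= 1 ->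
  pmean e (k * a) (k * b) t = k * pmean e a b t.
Proof.
move=> k0 a0 b0 t01; rewrite !pmean_pos ?mulr_gt0//; case: e => [r| |].
- have [[kn an] bn] := (ltW k0, ltW a0, ltW b0).
  case: (eqVneq r 0) => [_|r0].
    rewrite !powRM// mulrACA -powRD; last by rewrite (gt_eqF k0) implybT.
    by rewrite subrK powRr1.
  rewrite !powRM// !(mulrCA _ (k `^ r)) -mulrDr powRM ?powR_ge0//.
    by rewrite powRVK.
  by rewrite ltW// wsum_gt0// powR_gt0.
- by rewrite maxr_pMr// ltW.
- by rewrite minr_pMr// ltW.
Qed.

Lemma le_pmean e a b a' b' t : 0 < a -> 0 < b -> a <= a' -> b <= b' ->
  0 <= t <= 1 -> pmean e a b t <= pmean e a' b' t.
Proof.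
move=> a0 b0 aa bb t01; have [t0 t1] := andP t01.
have [a'0 b'0] := (lt_le_trans a0 aa, lt_le_trans b0 bb).
have [[[an bn] an'] bn'] := (ltW a0, ltW b0, ltW a'0, ltW b'0).
rewrite !pmean_pos//; case: e => [r| |].
- case: (eqVneq r 0) => [_|r0].
    by rewrite ler_pM ?powR_ge0// ge0_ler_powR// ?nnegrE// subr_ge0.
  case/orP: (lt_total r0) => [rn|rp].
    apply: le0_ler_powR; first by rewrite invr_le0 ltW.
      by rewrite wsum_gt0// powR_gt0.
    by apply: wsum_le => //; apply: le0_ler_powR => //; exact: ltW.
  apply: ge0_ler_powR; rewrite ?invr_ge0 ?(ltW rp)// ?nnegrE.
  - by rewrite ltW// wsum_gt0// powR_gt0.
  - by rewrite ltW// wsum_gt0// powR_gt0.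
  - by apply: wsum_le => //; apply: ge0_ler_powR; rewrite ?nnegrE ?(ltW rp).
- by rewrite ge_max !le_max aa bb orbT.
- by rewrite le_min !ge_min aa bb orbT.
Qed.

Lemma pmean_id e a t : 0 < a -> 0 <= t <= 1 -> pmean e a a t = a.
Proof.
move=> a0 t01; rewrite pmean_pos//; case: e => [r| |].
- case: (eqVneq r 0) => [_|r0].
    by rewrite -powRD ?subrK ?powRr1 ?(ltW a0)// (gt_eqF a0) implybT.
  by rewrite -mulrDl subrK mul1r powRVK// ltW.
- by rewrite maxxx.
- by rewrite minxx.
Qed.

Lemma pmean0 r a b : 0 < a -> 0 < b -> pmean r%:E a b 0 = a.
Proof.
move=> a0 b0; rewrite pmean_pos// subr0; case: (eqVneq r 0) => [_|r0].
  by rewrite powRr0 powRr1 ?mulr1// ltW.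
by rewrite mul1r mul0r addr0 powRVK// ltW.
Qed.

Lemma pmean1 r a b : 0 < a -> 0 < b -> pmean r%:E a b 1 = b.
Proof.
move=> a0 b0; rewrite pmean_pos// subrr; case: (eqVneq r 0) => [_|r0].
  by rewrite powRr0 powRr1 ?mul1r// ltW.
by rewrite mul1r mul0r add0r powRVK// ltW.
Qed.

(* The weighted AM-GM inequality, solved for the term whose weight is now at
   least 1. *)
Lemma reverse_young (k : R) a c : 1 <= k -> 0 < a -> 0 < c ->
  k * a + (1 - k) * c <= a `^ k * c `^ (1 - k).
Proof.
move=> k1 a0 c0; have k0 : 0 < k by lra.
set w := a `^ k * c `^ (1 - k).
have w0 : 0 < w by rewrite mulr_gt0// powR_gt0.
have t01 : 0 <= k^-1 <= 1 by rewrite invr_ge0 ltW//= invf_le1.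
have := weighted_AMGM t01 c0 w0.
have -> : c `^ (1 - k^-1) * w `^ k^-1 = a.
  rewrite /w powRM ?powR_ge0// powRVK ?gt_eqF// ?ltW//.
  rewrite -powRrM mulrCA -powRD; last by rewrite (gt_eqF c0) implybT.
  have -> : 1 - k^-1 + (1 - k) * k^-1 = 0 by field; rewrite gt_eqF.
  by rewrite powRr0 mulr1.
move=> H; have := ler_wpM2l (ltW k0) H.
have -> : k * ((1 - k^-1) * c + k^-1 * w) = (k - 1) * c + w.
  by field; rewrite gt_eqF.
by lra.
Qed.

(** With [k = q / (p + q) >= 1] one has [p * k = q * (1 - k) = l], so [reverse_young] bounds
    [(x * y) ^ l] from below by a combination of [x ^ p] and [y ^ q] whose average is
    [k + (1 - k) = 1]. As [l < 0], a sum that is at least 1 means a mean that is at most 1. *)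
Let pmean_mul_normalized p q a b c d t : p < 0 -> 0 < p + q ->
  0 < a -> 0 < b -> 0 < c -> 0 < d -> 0 <= t <= 1 ->
  (1 - t) * a `^ p + t * b `^ p = 1 -> (1 - t) * c `^ q + t * d `^ q = 1 ->
  pmean (p * q / (p + q))%:E (a * c) (b * d) t <= 1.
Proof.
move=> p0 pq a0 b0 c0 d0 t01 PP QQ.
have q0 : 0 < q by lra.
have l0 : p * q / (p + q) < 0 by rewrite pmulr_llt0 ?invr_gt0// pmulr_llt0.
set l := p * q / (p + q) in l0 *.
have -> : 1 = 1 `^ l^-1 :> R by rewrite powR1.
rewrite pmean_pos ?mulr_gt0// lt_eqF//.
apply: le0_ler_powR => //; first by rewrite invr_le0 ltW.
pose k := q / (p + q).
have k1 : 1 <= k by rewrite /k ler_pdivlMr//; lra.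
have E x y : 0 < x -> 0 < y -> k * x `^ p + (1 - k) * y `^ q <= (x * y) `^ l.
  move=> x0 y0; apply: le_trans (reverse_young k1 (powR_gt0 _ x0) (powR_gt0 _ y0)) _.
  rewrite -!powRrM powRM ?(ltW x0) ?(ltW y0)// /k /l mulrA.
  have -> : q * (1 - q / (p + q)) = p * q / (p + q) by field; rewrite gt_eqF.
  exact: lexx.
apply: le_trans (wsum_le t01 (E _ _ a0 c0) (E _ _ b0 d0)).
have -> : (1 - t) * (k * a `^ p + (1 - k) * c `^ q) +
    t * (k * b `^ p + (1 - k) * d `^ q) =
    k * ((1 - t) * a `^ p + t * b `^ p) +
    (1 - k) * ((1 - t) * c `^ q + t * d `^ q) by ring.
by rewrite PP QQ !mulr1 addrC subrK.
Qed.

Let pmean_normalize p a b t : p != 0 -> 0 < a -> 0 < b -> 0 <= t <= 1 ->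
  let k := (pmean p%:E a b t)^-1 in
  (1 - t) * (k * a) `^ p + t * (k * b) `^ p = 1.
Proof.
move=> p0 a0 b0 t01; have := pmean_gt0 p%:E a0 b0 t01.
have := pmean_pos p%:E t a0 b0.
move: (pmean _ _ _ _) => P; rewrite (negbTE p0) => PE P0 k.
rewrite /k !powRM ?invr_ge0 ?ltW// !(mulrCA _ (P^-1 `^ p)) -mulrDr.
have S0 : 0 < (1 - t) * a `^ p + t * b `^ p by rewrite wsum_gt0// powR_gt0.
rewrite -[X in _ * X](@powRKV p)// ?(ltW S0)// -PE.
by rewrite -powRM ?invr_ge0 ?ltW// mulVf ?gt_eqF// powR1.
Qed.

(** By homogeneity both pairs may be scaled to have mean 1. *)
Lemma pmean_mul p q a b c d t : p < 0 -> 0 < p + q ->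
  0 < a -> 0 < b -> 0 < c -> 0 < d -> 0 <= t <= 1 ->
  pmean (p * q / (p + q))%:E (a * c) (b * d) t <=
  pmean p%:E a b t * pmean q%:E c d t.
Proof.
move=> p0 pq a0 b0 c0 d0 t01.
have q0 : 0 < q by lra.
have := pmean_normalize (lt0r_neq0 q0) c0 d0 t01.
have := pmean_normalize (ltr0_neq0 p0) a0 b0 t01.
have := pmean_gt0 p%:E a0 b0 t01; have := pmean_gt0 q%:E c0 d0 t01.
move: (pmean p%:E _ _ _) (pmean q%:E _ _ _) => P Q Q0 P0 /= PP QQ.
have := pmean_mul_normalized p0 pq _ _ _ _ t01 PP QQ.
rewrite (mulrACA P^-1 a) (mulrACA P^-1 b).
rewrite !mulr_gt0 ?invr_gt0// => /(_ isT isT isT isT).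
rewrite pmeanZ ?mulr_gt0 ?invr_gt0// -invfM.
by rewrite ler_pdivrMl ?mulr_gt0// mulr1.
Qed.

(** The limiting case [q = - p]: a lower bound [m] for both products bounds [c] and [d] below in
    terms of [a] and [b], and after averaging the two power means of [a] and [b] cancel. *)
Lemma pmean_mul_opp p a b c d t : p < 0 ->
  0 < a -> 0 < b -> 0 < c -> 0 < d -> 0 <= t <= 1 ->
  pmean -oo (a * c) (b * d) t <=
  pmean p%:E a b t * pmean (- p)%:E c d t.
Proof.
move=> p0 a0 b0 c0 d0 t01; rewrite !pmean_pos ?mulr_gt0//.
rewrite oppr_eq0 lt_eqF//.
set m := Num.min _ _.
have m0 : 0 < m by rewrite lt_min !mulr_gt0.
have E x y : 0 < x -> 0 < y -> m <= x * y -> y `^ (- p) >= m `^ (- p) * x `^ p.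
  move=> x0 y0 mxy; rewrite -[x `^ p]invrK -powRN ler_pdivrMr ?powR_gt0//.
  rewrite -powRM ?(ltW x0) ?(ltW y0)// mulrC.
  by apply: ge0_ler_powR; rewrite ?nnegrE ?oppr_ge0 ?(ltW p0) ?(ltW m0) ?mulr_ge0
    ?(ltW x0) ?(ltW y0).
have ma : m <= a * c by rewrite ge_min lexx.
have mb : m <= b * d by rewrite ge_min lexx orbT.
have H := wsum_le t01 (E _ _ a0 c0 ma) (E _ _ b0 d0 mb).
rewrite !(mulrCA _ (m `^ _)) -mulrDr in H.
set A := (1 - t) * a `^ p + t * b `^ p in H *.
have A0 : 0 < A by rewrite wsum_gt0// powR_gt0.
have H2 : (m `^ (- p) * A) `^ (- p)^-1 <=
    ((1 - t) * c `^ (- p) + t * d `^ (- p)) `^ (- p)^-1.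
  rewrite ge0_ler_powR ?nnegrE ?invr_ge0 ?oppr_ge0 ?(ltW p0)//.
  - by rewrite mulr_ge0 ?powR_ge0 ?ltW.
  - by rewrite ltW// wsum_gt0// powR_gt0.
apply: le_trans (ler_wpM2l (powR_ge0 _ _) H2).
rewrite powRM ?powR_ge0 ?(ltW A0)// powRVK ?oppr_eq0 ?(lt_eqF p0) ?(ltW m0)//.
rewrite mulrCA -powRD; last by rewrite (gt_eqF A0) implybT.
by rewrite invrN addrN powRr0 mulr1.
Qed.

Lemma pmean0_le q c d t : 0 < q -> 0 < c -> 0 < d -> 0 <= t <= 1 ->
  pmean 0%:E c d t <= pmean q%:E c d t.
Proof.
move=> q0 c0 d0 t01; rewrite !(pmean_pos _ _ c0 d0) eqxx (gt_eqF q0).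
have := weighted_AMGM t01 (powR_gt0 q c0) (powR_gt0 q d0).
rewrite !(powRAC _ q) -powRM ?powR_ge0// => H.
rewrite -[leLHS](@powRVK q) ?gt_eqF ?mulr_ge0 ?powR_ge0//.
rewrite ge0_ler_powR ?invr_ge0 ?(ltW q0)// ?nnegrE ?powR_ge0//.
by rewrite ltW// wsum_gt0// powR_gt0.
Qed.

Lemma pmean0_mul a b c d t : 0 < a -> 0 < b -> 0 < c -> 0 < d ->
  pmean 0%:E (a * c) (b * d) t =
  pmean 0%:E a b t * pmean 0%:E c d t.
Proof.
move=> a0 b0 c0 d0; rewrite !pmean_pos ?mulr_gt0// eqxx.
by rewrite !powRM ?ltW// mulrACA.
Qed.

(** For [q = +oo] the larger of [c] and [d] comes out as a common factor. For [p = 0] the geometric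
    mean is multiplicative and lies below the mean of exponent [q]. For [p < 0] this is [pmean_mul];
    a nonzero [p = - q] would give the exponent [-oo], which [l%:E] excludes. *)
Lemma pmean_harmonic p (q : \bar R) l a b c d t : p <= 0 -> q != -oo%E ->
  (0%:E <= p%:E + q)%E -> harmonic_exponent p q = l%:E ->
  0 < a -> 0 < b -> 0 < c -> 0 < d -> 0 <= t <= 1 ->
  pmean l%:E (a * c) (b * d) t <=
  pmean p%:E a b t * pmean q c d t.
Proof.
move=> p0 + + + a0 b0 c0 d0 t01; case: q => [q| |//]; last first.
  move=> _ _ /= [<-]; rewrite [pmean +oo%E _ _ _]pmean_pos// [leRHS]mulrC.
  have m0 : 0 < Num.max c d by rewrite lt_max c0.
  rewrite -pmeanZ//; apply: le_pmean; rewrite ?mulr_gt0//.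
    by rewrite mulrC ler_wpM2r ?(ltW a0)// le_max lexx.
  by rewrite mulrC ler_wpM2r ?(ltW b0)// le_max lexx orbT.
move=> _; rewrite -EFinD lee_fin le_eqVlt => /predU1P[/esym pq0|pq0] /=.
  rewrite pq0 eqxx; case: ifPn => // /andP[/eqP-> /eqP->] [<-].
  by rewrite pmean0_mul.
rewrite gt_eqF// => -[<-]; move: p0; rewrite le_eqVlt => /predU1P[p0|p0].
  rewrite p0 !mul0r pmean0_mul// ler_wpM2l ?pmean0_le//.
    by rewrite ltW// pmean_gt0.
  by rewrite p0 add0r in pq0.
exact: pmean_mul.
Qed.

Lemma pmean_arithmetic c d t : 0 < c -> 0 < d -> 0 <= t <= 1 ->
  pmean 1%:E c d t = (1 - t) * c + t * d.
Proof.
move=> c0 d0 t01; rewrite pmean_pos// oner_eq0 invr1 !powRr1 ?ltW//.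
exact: wsum_gt0.
Qed.

(** The harmonic exponent of [l] and 1, where 1 is the exponent with which side lengths are
    averaged. On reciprocals of nonzero exponents it is the shift by 1, so [n] steps lead from [l]
    to [l / (1 + n * l)]. *)
Let next_exponent l : \bar R := if 1 + l == 0 then -oo%E else (l / (1 + l))%:E.

Let pmean_mul1 l a b c d t : l <= 0 -> 0 <= 1 + l ->
  0 < a -> 0 < b -> 0 < c -> 0 < d -> 0 <= t <= 1 ->
  pmean (next_exponent l) (a * c) (b * d) t <=
  pmean l%:E a b t * ((1 - t) * c + t * d).
Proof.
move=> l0 l1 a0 b0 c0 d0 t01; rewrite -pmean_arithmetic// /next_exponent.
case: ifPn => [/eqP l10|l10].
  have -> : 1 = - l :> R by lra.
  by apply: pmean_mul_opp => //; lra.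
have l1' : 0 < l + 1 by rewrite addrC lt_neqAle eq_sym l10.
move: l0; rewrite le_eqVlt => /predU1P[l0|l0].
  rewrite l0 mul0r pmean0_mul//; apply: ler_wpM2l.
    by rewrite ltW// pmean_gt0.
  exact: pmean0_le.
by rewrite (addrC 1); have := pmean_mul l0 l1' a0 b0 c0 d0 t01; rewrite mulr1.
Qed.

(** The inequality for one box on either side, with heights [c], [d] and side lengths [a i], [b i]:
    each side costs one step of [next_exponent]. *)
Lemma pmean_box n l (a b : 'I_n -> R) c d t : (0 < n)%N -> l <= 0 ->
  - n%:R^-1 <= l -> 0 < c -> 0 < d ->
  (forall i, 0 < a i) -> (forall i, 0 < b i) -> 0 <= t <= 1 ->
  pmean (convolution_exponent n l%:E) (c * \prod_i a i) (d * \prod_i b i) t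
  <= pmean l%:E c d t * \prod_i ((1 - t) * a i + t * b i).
Proof.
move=> n0 l0 ln c0 d0 a0 b0 t01.
have nR : 0 < n%:R :> R by rewrite ltr0n.
(* The test in [convolution_exponent] involves the inverse of [n], which is 0 at [n = 0]; in the
   form [1 + n%:R * l == 0] it is also right there, where the induction starts. *)
have -> : convolution_exponent n l%:E =
    if 1 + n%:R * l == 0 then -oo%E else (l / (1 + n%:R * l))%:E.
  rewrite /convolution_exponent; congr (if _ then _ else _).
  apply/eqP/eqP => [->|]; first by rewrite mulrN divff ?gt_eqF// subrr.
  move=> h; apply: (mulfI (lt0r_neq0 nR)); rewrite mulrN divff ?gt_eqF//; lra.
have {ln n0 nR} : 0 <= 1 + n%:R * l.
  move: (ler_wpM2l (ltW nR) ln); rewrite mulrN divff ?gt_eqF//; lra.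
elim: n a b a0 b0 => [|n IH] a b a0 b0 ln.
  rewrite !big_ord0 mul0r addr0 oner_eq0 divr1 !mulr1//.
have ln' : 0 <= 1 + n%:R * l by move: ln; rewrite -natr1 mulrDl mul1r; lra.
(* As [l <= 0], the denominator can vanish only at the last side, so the induction hypothesis never
   has the exponent [-oo]. *)
have ln1 : 0 < 1 + n%:R * l.
  move: ln'; rewrite le_eqVlt => /predU1P[e|//].
  move: ln; rewrite -natr1; have [->|l0'] := eqVneq l 0.
    by rewrite !mulr0 !addr0 ltr01.
  by move: l0 l0'; rewrite le_eqVlt => /predU1P[->|]; rewrite ?eqxx//; lra.
have {IH} := IH (fun i => a (widen_ord (leqnSn n) i))
  (fun i => b (widen_ord (leqnSn n) i)) (fun i => a0 _) (fun i => b0 _) ln'.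
rewrite gt_eqF// !big_ord_recr/=.
set A := \prod_(i < n) _; set B := \prod_(i < n) _; set C := \prod_(i < n) _.
have A0 : 0 < A by apply: prodr_gt0.
have B0 : 0 < B by apply: prodr_gt0.
move=> IH; rewrite !mulrA.
have C0 : 0 < (1 - t) * a ord_max + t * b ord_max by rewrite wsum_gt0.
apply: le_trans (ler_wpM2r (ltW C0) IH).
set l' := l / (1 + n%:R * l).
have l'0 : l' <= 0 by rewrite /l' pmulr_lle0 ?invr_gt0.
have E : 1 + l' = (1 + n.+1%:R * l) / (1 + n%:R * l).
  by rewrite /l' -natr1; field; rewrite gt_eqF.
have l'1 : 0 <= 1 + l' by rewrite E divr_ge0.
have := pmean_mul1 l'0 l'1 (mulr_gt0 c0 A0) (mulr_gt0 d0 B0) (a0 ord_max)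
  (b0 ord_max) t01.
rewrite /next_exponent E mulf_eq0 invr_eq0 (gt_eqF ln1) orbF.
case: ifPn => // h; apply: le_trans; rewrite le_eqVlt; apply/orP; left; apply/eqP.
have -> // : l / (1 + n.+1%:R * l) =
  l' / ((1 + n.+1%:R * l) / (1 + n%:R * l)).
rewrite /l'; move: h ln1; move: (1 + n.+1%:R * l) (1 + n%:R * l) => x y x0 y0.
by field; rewrite x0 gt_eqF.
Qed.

End power_means.

(** * Lebesgue measure of boxes *)

(** Turns the unordered sums of [lebesgue_outer] into series, the form taken by countable
    subadditivity and term by term integration. *)
Lemma esum_countable (R : realType) (T : pointedType) (S : set T)
    (a : T -> \bar R) :
  countable S -> (forall x, S x -> (0 <= a x)%E) ->
  exists (D : set nat) (e : nat -> T), e @` D = S /\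
    (\esum_(x in S) a x = \sum_(k <oo | k \in D) a (e k))%E.
Proof.
move=> /countable_bijP[D]; rewrite card_eq_sym => /card_set_bijP[e [eh ei es]] a0.
have eD : set_bij D S e by [].
have eDS : e @` D = S.
  by apply/seteqP; split=> [_ [k Dk <-]|x /es//]; exact: eh.
exists D, e; split => //.
rewrite (@reindex_esum _ _ _ D S e a eD) nneseries_esum; last first.
  by move=> k; rewrite inE => Dk; apply: a0; rewrite -eDS; exists k.
by congr esum; apply/seteqP; split=> k /=; rewrite inE.
Qed.

Section boxes.
Context {R : realType} {n : nat}.
Implicit Types (p q : 'rV[R]_n * 'rV[R]_n) (x y : 'rV[R]_n) (i j : 'I_n).
Local Notation box := (@box R n).
Local Notation lebo := (lebesgue_outer R n).
Local Notation mu := (lebesgue_measure_rV R n).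

Lemma box_volume_ge0 p : 0 <= box_volume p.
Proof. by apply: prodr_ge0 => i _; rewrite le_max lexx. Qed.

Lemma lebesgue_outer_box_le p : (lebo (box p) <= (box_volume p)%:E)%E.
Proof.
apply: ereal_inf_lbound; exists [set p].
  by split; [exact: countable1|move=> x px; exists p].
by rewrite esum_set1// lee_fin box_volume_ge0.
Qed.

(** An indexed family may repeat a box, whereas [lebesgue_outer] sums over sets of boxes; countable
    subadditivity bridges the two. *)
Lemma lebesgue_outer_cover (T : pointedType) (S : set T)
    (b : T -> 'rV[R]_n * 'rV[R]_n) (A : set 'rV[R]_n) : countable S ->
  A `<=` \bigcup_(k in S) box (b k) ->
  (lebo A <= \esum_(k in S) (box_volume (b k))%:E)%E.
Proof.
move=> cS AS.
have [||D [e [eD ->]]] := @esum_countable R T S (fun k => (box_volume (b k))%:E).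
- by [].
- by move=> k _; rewrite lee_fin box_volume_ge0.
pose F k := if k \in D then box (b (e k)) else set0.
apply: (@le_trans _ _ (lebo (\bigcup_k F k))).
  apply: le_outer_measure => x /AS; rewrite -eD => -[_ [k Dk <-] xk].
  by exists k => //; rewrite /F mem_set.
apply: le_trans (outer_measure_sigma_subadditive _ _) _.
rewrite [leRHS]eseries_mkcond; apply: lee_nneseries.
  by move=> k _ _; exact: outer_measure_ge0.
move=> k _; rewrite /F; case: ifPn => _; last by rewrite outer_measure0.
exact: lebesgue_outer_box_le.
Qed.

Definition set_coord x i (s : R) : 'rV[R]_n :=
  \row_j if j == i then s else x 0 j.

(** A hyperplane that misses the box leaves one of the two pieces degenerate, and the [Num.max 0] in
    [box_volume] gives that piece volume 0. *)
Definition box_cutl i (e : R) p : 'rV[R]_n * 'rV[R]_n :=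
  (p.1, set_coord p.2 i (Num.min (p.2 0 i) e)).
Definition box_cutr i (e : R) p : 'rV[R]_n * 'rV[R]_n :=
  (set_coord p.1 i (Num.max (p.1 0 i) e), p.2).

Lemma box_cutlE i e p : box (box_cutl i e p) = box p `&` [set x | x 0 i <= e].
Proof.
apply/seteqP; split=> [x /= xp|x /= [xp xe] j].
  split=> [j|]; last by have := xp i; rewrite /= !mxE eqxx le_min => /and3P[].
  have := xp j; rewrite /= !mxE; case: eqP => // ->.
  by rewrite le_min => /and3P[-> ->].
by rewrite !mxE; case: eqP => // ->; rewrite le_min xe andbT.
Qed.

Lemma box_cutrE i e p : box (box_cutr i e p) = box p `&` [set x | e < x 0 i].
Proof.
apply/seteqP; split=> [x /= xp|x /= [xp xe] j].
  split=> [j|]; last by have := xp i; rewrite /= !mxE eqxx gt_max -andbA => /and3P[].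
  have := xp j; rewrite /= !mxE; case: eqP => // ->.
  by rewrite gt_max -andbA => /and3P[-> _ ->].
by rewrite !mxE; case: eqP => // ->; rewrite gt_max xe andbT.
Qed.

Lemma box_volume_cutl i e p : box_volume (box_cutl i e p) =
  Num.max 0 (Num.min (p.2 0 i) e - p.1 0 i) *
  \prod_(j | j != i) Num.max 0 (p.2 0 j - p.1 0 j).
Proof.
rewrite /box_volume (bigD1 i)//= !mxE eqxx; congr (_ * _).
by apply: eq_bigr => j /negbTE ji; rewrite !mxE ji.
Qed.

Lemma box_volume_cutr i e p : box_volume (box_cutr i e p) =
  Num.max 0 (p.2 0 i - Num.max (p.1 0 i) e) *
  \prod_(j | j != i) Num.max 0 (p.2 0 j - p.1 0 j).
Proof.
rewrite /box_volume (bigD1 i)//= !mxE eqxx; congr (_ * _).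
by apply: eq_bigr => j /negbTE ji; rewrite !mxE ji.
Qed.

Lemma box_volume_cut i e p :
  box_volume (box_cutl i e p) + box_volume (box_cutr i e p) = box_volume p.
Proof.
rewrite box_volume_cutl box_volume_cutr -mulrDl /box_volume [RHS](bigD1 i)//=.
congr (_ * _); move: (p.1 0 i) (p.2 0 i) => u v.
by rewrite /Num.max /Num.min; do !case: ifPn; rewrite -?leNgt => *; lra.
Qed.

(** Caratheodory's criterion: the hyperplane cuts every cover of [X] into covers of the two parts of
    [X] with the same total volume. *)
Lemma measurable_halfspace i e :
  measurable ([set x | x 0 i <= e] : set (lebesgue_rV R n)).
Proof.
apply: le_caratheodory_measurable => X.
apply: le_ereal_inf_tmp => _ [S [cS XS] <-].
apply: (@le_trans _ _ (\esum_(p in S) (box_volume (box_cutl i e p))%:E +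
    \esum_(p in S) (box_volume (box_cutr i e p))%:E)%E); last first.
  rewrite -esumD; last 2 first.
    by move=> *; rewrite lee_fin box_volume_ge0.
    by move=> *; rewrite lee_fin box_volume_ge0.
  by apply: le_esum => p _; rewrite -EFinD box_volume_cut.
apply: leeD; apply: lebesgue_outer_cover => // x [Xx xe].
  by have [p Sp px] := XS _ Xx; exists p => //; rewrite box_cutlE.
have [p Sp px] := XS _ Xx; exists p => //; rewrite box_cutrE; split => //=.
by rewrite ltNge; exact/negP.
Qed.

Lemma measurable_box p : measurable (box p : set (lebesgue_rV R n)).
Proof.
have -> : box p = \bigcap_(i in [set: 'I_n])
    (~` [set x | x 0 i <= p.1 0 i] `&` [set x | x 0 i <= p.2 0 i]).
  apply/seteqP; split=> [x xp i _ /=|x xp i].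
    by have /andP[p1 p2] := xp i; split=> //; apply/negP; rewrite -ltNge.
  by have [/= /negP + ->] := xp i I; rewrite -ltNge => ->.
apply: fin_bigcap_measurable => // i _; apply: measurableI.
  by apply: measurableC; exact: measurable_halfspace.
exact: measurable_halfspace.
Qed.

(* Integrating the coordinates one at a time turns the pointwise inequality
   between indicators of boxes, products of one-dimensional indicators, into
   the inequality between volumes. *)
Let mixed m p x : R := \prod_(j < n)
  if (j < m)%N then Num.max 0 (p.2 0 j - p.1 0 j)
  else (p.1 0 j < x 0 j <= p.2 0 j)%R%:R.

Let mixed_ge0 m p x : 0 <= mixed m p x.
Proof.
by apply: prodr_ge0 => j _; case: ifP => _; rewrite ?le_max ?lexx// ler0n.
Qed.

Let mixed_set_coord i p x s : mixed i p (set_coord x i s) =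
  (\prod_(j < n | j != i) if (j < i)%N then Num.max 0 (p.2 0 j - p.1 0 j)
     else (p.1 0 j < x 0 j <= p.2 0 j)%R%:R) * \1_(`]p.1 0 i, p.2 0 i]%classic) s.
Proof.
rewrite /mixed (bigD1 i)//= ltnn mulrC; congr (_ * _).
  by apply: eq_bigr => j /negbTE ji; rewrite mxE ji.
rewrite !mxE eqxx indicE; congr (nat_of_bool _)%:R.
by apply/idP/idP; rewrite inE/= in_itv.
Qed.

Let measurable_mixed i p x :
  measurable_fun [set: R] (fun s : R => (mixed i p (set_coord x i s))%:E).
Proof.
apply/measurable_EFinP => /=; under eq_fun do rewrite mixed_set_coord.
by apply: measurable_funM => //; exact: measurable_indic.
Qed.

Let integral_mixed i p x :
  (\int[lebesgue_measure]_s (mixed i p (set_coord x i s))%:E =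
   (mixed i.+1 p x)%:E)%E.
Proof.
under eq_integral do rewrite mixed_set_coord EFinM.
rewrite ge0_integralZl//; first last.
- rewrite lee_fin; apply: prodr_ge0 => j _.
  by case: ifP => _; rewrite ?le_max ?lexx// ler0n.
- by apply/measurable_EFinP; exact: measurable_indic.
rewrite integral_indic// setIT [X in (_ * X)%E]lebesgue_measure_itv/= lte_fin.
rewrite /mixed [in RHS](bigD1 i)//= ltnSn mulrC EFinM; congr (_ * _)%E.
  congr (_%:E); apply: eq_bigr => j ji.
  by rewrite ltnS [in RHS]leq_eqVlt -val_eqE/= in ji *; rewrite (negbTE ji).
by rewrite /Num.max subr_gt0; case: ifP.
Qed.

Lemma box_volume_le_cover (D : set nat) (b : nat -> 'rV[R]_n * 'rV[R]_n) p :
  box p `<=` \bigcup_(k in D) box (b k) ->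
  ((box_volume p)%:E <= \sum_(k <oo | k \in D) (box_volume (b k))%:E)%E.
Proof.
(* [m] counts the integrated coordinates. At [m = 0] the claim compares indicators and follows from
   the inclusion; at [m = n] the point [x] has dropped out. *)
move=> pD; suff H : forall m, (m <= n)%N -> forall x,
    ((mixed m p x)%:E <= \sum_(k <oo | k \in D) (mixed m (b k) x)%:E)%E.
  have E q : mixed n q 0 = box_volume q.
    by apply: eq_bigr => j _; rewrite ltn_ord.
  by have := H n (leqnn n) 0; under eq_eseriesr do rewrite E; rewrite E.
elim=> [_ x|m IH mn x].
  have mE q : mixed 0 q x = (`[<box q x>])%:R.
    rewrite /mixed; have [xq|xq] := asboolP.
      by apply: big1 => j _ /=; rewrite (xq j).
    have /existsP[j jq] : [exists j, ~~ (q.1 0 j < x 0 j <= q.2 0 j)].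
      by apply: contra_notT xq; rewrite negb_exists => /forallP + j => /(_ j)/negPn.
    by rewrite (bigD1 j)//= (negbTE jq) mul0r.
  rewrite mE; have [/pD[k Dk xk]|_] := asboolP; last first.
    by apply: nneseries_ge0 => k _ _; rewrite lee_fin.
  rewrite (@nneseriesD1 _ _ k) ?mem_set//; last by move=> *; rewrite lee_fin.
  rewrite mE asboolT// leeDl// nneseries_ge0// => *.
  by rewrite lee_fin.
pose i := Ordinal mn.
rewrite -(integral_mixed i) [leRHS]eseries_mkcond.
have -> : (\sum_(k <oo) (if k \in D then (mixed m.+1 (b k) x)%:E else 0) =
    \sum_(k <oo) \int[lebesgue_measure]_s
      (if k \in D then (mixed i (b k) (set_coord x i s))%:E else 0))%E.
  apply: eq_eseriesr => k _; case: (k \in D); last by rewrite integral0.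
  by rewrite (integral_mixed i).
rewrite -integral_nneseries//; first last.
- by move=> k s _; case: (k \in D); rewrite ?lee_fin.
- by move=> k; case: (k \in D) => //; exact: measurable_mixed.
apply: ge0_le_integral => //.
- by move=> s _; rewrite lee_fin.
- exact: measurable_mixed.
- apply: ge0_emeasurable_sum => //.
  + by move=> k s _ _; case: (k \in D); rewrite ?lee_fin.
  + by move=> k _; case: (k \in D) => //; exact: measurable_mixed.
- by move=> s _; rewrite -eseries_mkcond; exact/IH/ltnW.
Qed.

End boxes.

Section lebesgue_measure_boxes.
Context {R : realType} {n : nat}.
Implicit Types (p q : 'rV[R]_n * 'rV[R]_n) (x y : 'rV[R]_n) (i j : 'I_n).
Local Notation box := (@box R n).
Local Notation lebo := (lebesgue_outer R n).
Local Notation mu := (lebesgue_measure_rV R n).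

Lemma lebesgue_measure_box p : mu (box p) = (box_volume p)%:E.
Proof.
apply/eqP; rewrite eq_le lebesgue_outer_box_le/=.
apply: le_ereal_inf_tmp => _ [S [cS pS] <-].
have [||D [e [eD ->]]] := @esum_countable R _ S (fun q => (box_volume q)%:E).
- by [].
- by move=> q _; rewrite lee_fin box_volume_ge0.
apply: box_volume_le_cover => x /pS; rewrite -eD => -[_ [k Dk <-] xk].
by exists k.
Qed.

Lemma nbhs_rVP x (A : set 'rV[R]_n) : nbhs x A <->
  exists2 e : R, 0 < e & forall y, (forall i, `|x 0 i - y 0 i| < e) -> A y.
Proof.
split=> [/nbhs_ballP[e /= e0 xA]|[e e0 xA]].
  exists e => // y xy; apply: xA; split=> // k i.
  by rewrite ord1; exact: xy.
apply/nbhs_ballP; exists e => //= y [_ xy]; apply: xA => i.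
exact: xy.
Qed.

(** The boxes with rational corners contained in [A] are countably many and exhaust it. *)
Lemma open_lebesgue_measurable (A : set 'rV[R]_n) : open A ->
  measurable (A : set (lebesgue_rV R n)).
Proof.
move=> oA; pose rbox (ab : 'rV[rat]_n * 'rV[rat]_n) :=
  (map_mx ratr ab.1 : 'rV[R]_n, map_mx ratr ab.2 : 'rV[R]_n).
have -> : A = \bigcup_ab (if `[<box (rbox ab) `<=` A>] then box (rbox ab) else set0).
  apply/seteqP; split=> [x Ax|x [ab _]]; last first.
    by case: asboolP => [abA|//]; exact: abA.
  have /nbhs_rVP[e e0 xA] : nbhs x A by exact: open_nbhs_nbhs.
  have [a aP] : {a : 'I_n -> rat & forall i, x 0 i - e < ratr (a i) < x 0 i}.
    apply: (@choice _ _ (fun i r => x 0 i - e < ratr r < x 0 i)) => i.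
    have : x 0 i - e < x 0 i by rewrite gtrBl.
    by move=> /rat_in_itvoo[r]; rewrite in_itv/=; exists r.
  have [b bP] : {b : 'I_n -> rat & forall i, x 0 i < ratr (b i) < x 0 i + e}.
    apply: (@choice _ _ (fun i r => x 0 i < ratr r < x 0 i + e)) => i.
    have : x 0 i < x 0 i + e by rewrite ltrDl.
    by move=> /rat_in_itvoo[r]; rewrite in_itv/=; exists r.
  exists (\row_i a i, \row_i b i) => //.
  rewrite asboolT.
    by move=> i; rewrite /rbox/= !mxE; move: (aP i) (bP i); lra.
  move=> y xy; apply: xA => i; move: (xy i) (aP i) (bP i).
  rewrite /rbox/= !mxE => /andP[h1 h2] /andP[h3 h4] /andP[h5 h6].
  rewrite ltr_norml; lra.
apply: countable_bigcupT_measurable => // ab.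
by case: asboolP => _ //; exact: measurable_box.
Qed.

Lemma continuous_lebesgue_measurable (f : 'rV[R]_n -> R) : continuous f ->
  lebesgue_measurable_fun f.
Proof.
move=> /continuousP cf; apply: (measurability _ (RGenOpens.measurableE R)).
move=> _ [_ [a [b ->] <-]]; rewrite setTI; apply: open_lebesgue_measurable.
exact/cf/interval_open.
Qed.

(** The image of a cover by boxes is a cover by boxes with volumes multiplied by [c ^+ n]. *)
Lemma lebesgue_outer_affine (c : R) (v : 'rV[R]_n) (A : set 'rV[R]_n) : 0 < c ->
  (lebo ((fun x => (c *: x + v)%R) @` A) <= (c ^+ n)%:E * lebo A)%E.
Proof.
move=> c0; have cn0 : 0 < c ^+ n by rewrite exprn_gt0.
rewrite -lee_pdivrMl//; apply: le_ereal_inf_tmp => _ [S [cS AS] <-].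
have [||D [e [eD ->]]] := @esum_countable R _ S (fun q => (box_volume q)%:E).
- by [].
- by move=> q _; rewrite lee_fin box_volume_ge0.
rewrite lee_pdivrMl// -nneseriesZl; last first.
  by move=> k _; rewrite lee_fin box_volume_ge0.
pose b k := (c *: (e k).1 + v, c *: (e k).2 + v).
have bE k : box_volume (b k) = c ^+ n * box_volume (e k).
  rewrite /box_volume -[X in c ^+ X](card_ord n) -prodr_const -big_split/=.
  apply: eq_bigr => i _; rewrite !mxE opprD addrACA subrr addr0 -mulrBr.
  by rewrite maxr_pMr ?mulr0// ltW.
rewrite nneseries_esum; last first.
  by move=> k _; rewrite -EFinM lee_fin mulr_ge0 ?box_volume_ge0 ?(ltW cn0).
under eq_esum do rewrite -EFinM -bE.
apply: lebesgue_outer_cover; first exact: countableP.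
move=> _ [x /AS + <-]; rewrite -eD => -[_ [k Dk <-] xk].
exists k; first by rewrite /= mem_set.
by move=> i; have /andP[h1 h2] := xk i; rewrite !mxE lerD2r ltrD2r ltr_pM2l//
  ler_pM2l// h1.
Qed.

Lemma coord_le_norm x i : `|x 0 i| <= `|x|.
Proof.
rewrite [leRHS]/Num.norm/= mx_normrE; apply/bigmax_geP; right.
by exists (0, i).
Qed.

Lemma bounded_lebesgue_outer (A : set 'rV[R]_n) : bounded_set A ->
  (lebo A < +oo)%E.
Proof.
move=> [M [_ /(_ (M + 1)) H]].
have {}H x : A x -> `|x| <= M + 1 by apply: H; rewrite ltrDl.
apply: (@le_lt_trans _ _ (lebo (box (const_mx (- (M + 2)), const_mx (M + 2))))).
  apply: le_outer_measure => x /H xM i; rewrite !mxE/=.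
  have : `|x 0 i| <= M + 1 by exact: le_trans (coord_le_norm _ _) xM.
  by rewrite ler_norml; lra.
exact: le_lt_trans (lebesgue_outer_box_le _) (ltry _).
Qed.

End lebesgue_measure_boxes.

(** * Convex functions *)

Section convex_functions.
Context {R : realType} {n : nat}.
Implicit Types (A : set 'rV[R]_n) (phi : 'rV[R]_n -> R) (x y : 'rV[R]_n).

Definition convex_on A phi := forall x y (t : R), A x -> A y -> 0 <= t <= 1 ->
  A ((1 - t) *: x + t *: y) /\
  phi ((1 - t) *: x + t *: y) <= (1 - t) * phi x + t * phi y.

(* On a cube, a convex function is bounded by its values at the vertices. *)
Lemma convex_on_local_bound A phi x : convex_on A phi -> interior A x ->
  exists (r C : R), 0 < r /\
    forall y, (forall i, `|x 0 i - y 0 i| <= r) -> A y /\ phi y <= C.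
Proof.
move=> cphi /nbhs_rVP[e e0 xA]; set r := e / 2.
have r0 : 0 < r by rewrite divr_gt0.
have {}xA y : (forall i, `|x 0 i - y 0 i| <= r) -> A y.
  move=> xy; apply: xA => i; apply: le_lt_trans (xy i) _.
  by rewrite /r ltr_pdivrMr// ltr_pMr// ltr1n.
pose corner (b : {ffun 'I_n -> bool}) : 'rV[R]_n :=
  \row_i (x 0 i + if b i then r else - r).
exists r, (\sum_b `|phi (corner b)|); split => // y xy; split; first exact: xA.
set C := \sum_b _.
(* Coordinates of index at least [k] sit at an end of their interval, the others are free. At
   [k = 0] the point is a vertex; freeing one more coordinate costs one convex combination of the
   two ends. *)
suff H k : (k <= n)%N -> forall y, (forall i, `|x 0 i - y 0 i| <= r) ->
    (forall i : 'I_n, (k <= i)%N -> y 0 i = x 0 i + r \/ y 0 i = x 0 i - r) ->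
    phi y <= C.
  by apply: (H n) => // i; rewrite leqNgt ltn_ord.
elim: k {y xy} => [_ y _ yc|k IH kn y xy yc].
  have -> : y = corner [ffun i => y 0 i == x 0 i + r].
    apply/rowP => i; rewrite !mxE ffunE; have [//|/eqP h] := eqVneq.
    by have [] := yc i (leq0n _).
  by rewrite /C (bigD1 [ffun i => y 0 i == x 0 i + r])//=
    (le_trans (ler_norm _))// lerDl sumr_ge0.
pose i := Ordinal kn; pose t := (y 0 i - x 0 i + r) / (2 * r).
have t01 : 0 <= t <= 1.
  have := xy i; rewrite ler_norml => /andP[h1 h2].
  by apply/andP; split; rewrite /t ?ler_pdivrMr ?ler_pdivlMr; lra.
have yE : y = (1 - t) *: set_coord y i (x 0 i - r) + t *: set_coord y i (x 0 i + r).
  apply/rowP => j; rewrite !mxE; case: eqP => [->|_]; last by ring.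
  by rewrite /t; field; rewrite gt_eqF.
have H s : `|s| = r -> (s = r \/ s = - r) ->
    A (set_coord y i (x 0 i + s)) /\ phi (set_coord y i (x 0 i + s)) <= C.
  move=> sr sE; have xy' j : `|x 0 j - set_coord y i (x 0 i + s) 0 j| <= r.
    rewrite !mxE; case: eqP => [->|_]; last exact: xy.
    by rewrite opprD addNKr normrN sr.
  split; first exact: xA.
  apply: IH => //; first exact: ltnW.
  move=> j; rewrite leq_eqVlt => /predU1P[kj|kj].
    have -> : j = i by apply/val_inj.
    by rewrite !mxE eqxx; case: sE => ->; [left|right].
  by rewrite !mxE -val_eqE/= gtn_eqF//; exact: yc.
have [|ar br] := H r _ (or_introl erefl); first by rewrite gtr0_norm.
have [|al bl] := H (- r) _ (or_intror erefl); first by rewrite normrN gtr0_norm.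
rewrite [in leLHS]yE; have [_] := cphi _ _ _ al ar t01; move=> /le_trans; apply.
have -> : C = (1 - t) * C + t * C by ring.
exact: wsum_le.
Qed.

(** On the line through [x] and [y], the points [w d^-1] and [w (- d^-1)] stay in a cube where
    [phi <= C]. Since [y] lies between [x] and the first, [phi y] is bounded above; since [x] lies
    between [y] and the second, [phi y] is bounded below. *)
Lemma convex_on_continuous A phi x : convex_on A phi -> interior A x ->
  {for x, continuous phi}.
Proof.
move=> cphi /(convex_on_local_bound cphi)[r [C [r0 H]]].
have [Ax phiC] : A x /\ phi x <= C.
  by apply: H => i; rewrite subrr normr0 ltW.
apply/(@cvgrPdist_le _ _ _ _ (nbhs_filter x)) => e e0; apply/nbhs_rVP.
(* The [e] in the denominator keeps [d] positive and at most 1 even when [C = phi x]. *)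
pose d := e / (C - phi x + e).
have d0 : 0 < d by rewrite divr_gt0//; lra.
have d1 : d <= 1 by rewrite /d ler_pdivrMr; lra.
have de : d * (C - phi x) <= e.
  by rewrite /d mulrAC ler_pdivrMr; [rewrite ler_pM2l//|]; lra.
exists (d * r); first by rewrite mulr_gt0.
move=> y xy; pose w s := x + s *: (y - x).
have wr s : `|s| = d^-1 -> A (w s) /\ phi (w s) <= C.
  move=> sd; apply: H => i; rewrite !mxE opprD addNKr normrN normrM sd.
  by rewrite distrC ler_pdivrMl// ltW.
have [|a1 b1] := wr d^-1; first by rewrite gtr0_norm ?invr_gt0.
have [|a2 b2] := wr (- d^-1); first by rewrite normrN gtr0_norm ?invr_gt0.
have t01 : 0 <= d <= 1 by rewrite (ltW d0).
have yE : (1 - d) *: x + d *: w d^-1 = y.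
  by apply/rowP => i; rewrite !mxE; field; rewrite gt_eqF.
have [] := cphi _ _ _ Ax a1 t01; rewrite yE => Ay Hy.
have d10 : 0 < 1 + d by lra.
have u01 : 0 <= d / (1 + d) <= 1.
  by rewrite divr_ge0 ?(ltW d10) ?(ltW d0)//= ler_pdivrMr// mul1r lerDr.
have xE : (1 - d / (1 + d)) *: y + (d / (1 + d)) *: w (- d^-1) = x.
  by apply/rowP => i; rewrite !mxE; field; rewrite !gt_eqF.
have [_] := cphi _ _ _ Ay a2 u01; rewrite xE => Hx.
have {}Hx : (1 + d) * phi x <= phi y + d * phi (w (- d^-1)).
  have := ler_wpM2l (ltW d10) Hx.
  suff -> : (1 + d) * ((1 - d / (1 + d)) * phi y + d / (1 + d) * phi (w (- d^-1)))
    = phi y + d * phi (w (- d^-1)) by [].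
  by field; rewrite gt_eqF.
have B1 := ler_wpM2l (ltW d0) b1; have B2 := ler_wpM2l (ltW d0) b2.
rewrite /= ler_norml; lra.
Qed.

(** The interior point [x] lies between [y] and the point [x - s *: (y - x)], where [phi <= C]; a
    very negative [phi y] would force [phi x] below its value. *)
Lemma convex_on_bounded_below A phi : convex_on A phi -> bounded_set A ->
  interior A !=set0 -> exists c : R, forall y, A y -> c <= phi y.
Proof.
move=> cphi [M [_ /(_ (M + 1)) HM]] [x /(convex_on_local_bound cphi)[r [C [r0 H]]]].
have {}HM y : A y -> `|y| <= M + 1 by apply: HM; rewrite ltrDl.
have Ax : A x by apply: (H x _).1 => i; rewrite subrr normr0 ltW.
have M0 : 0 <= M + 1 by apply: le_trans (HM _ Ax).
(* Points of [A] are at distance at most [2 * (M + 1)] from [x], so the reflected point stays in the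
   cube of radius [r]. *)
pose s := r / (2 * (M + 2)).
have s0 : 0 < s by rewrite /s divr_gt0//; lra.
have s10 : 0 < 1 + s by lra.
have t01 : 0 <= s / (1 + s) <= 1.
  by rewrite divr_ge0 ?(ltW s10) ?(ltW s0)//= ler_pdivrMr// mul1r lerDr.
exists (((1 + s) * phi x - C) / s) => y Ay.
have [|a b] := H (x - s *: (y - x)).
  move=> i; rewrite !mxE.
  have -> : x 0 i - (x 0 i - s * (y 0 i - x 0 i)) = s * (y 0 i - x 0 i) by ring.
  rewrite normrM gtr0_norm//.
  rewrite /s mulrAC ler_pdivrMr; last lra.
  rewrite ler_pM2l//; apply: (le_trans (ler_normB _ _)).
  have := coord_le_norm y i; have := coord_le_norm x i.
  have := HM _ Ay; have := HM _ Ax; lra.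
have xE : (1 - s / (1 + s)) *: (x - s *: (y - x)) + (s / (1 + s)) *: y = x.
  by apply/rowP => i; rewrite !mxE; field; rewrite gt_eqF.
have [_] := cphi _ _ _ a Ay t01; rewrite xE => Hx.
rewrite ler_pdivrMr//; have := ler_wpM2l (ltW s10) Hx.
set v := phi (x - _) in b *.
have -> : (1 + s) * ((1 - s / (1 + s)) * v + s / (1 + s) * phi y) = v + s * phi y.
  by field; rewrite gt_eqF.
lra.
Qed.

(** Contracting [y] towards [x] leads into the interior: every point near the contracted one is a
    convex combination of [y] and a point [w] near [x]. *)
Lemma convex_interior_dilation A phi x (c : R) : convex_on A phi -> interior A x ->
  1 < c -> A `<=` (fun z => c *: z + (1 - c) *: x) @` (interior A).
Proof.
move=> cphi /nbhs_rVP[e e0 xA] c1 y Ay; have c0 : 0 < c by lra.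
exists (c^-1 *: y + (1 - c^-1) *: x); last first.
  by apply/rowP => i; rewrite !mxE; field; rewrite gt_eqF.
have d0 : 0 < 1 - c^-1 by rewrite subr_gt0 invf_lt1.
apply/nbhs_rVP; exists ((1 - c^-1) * e); first by rewrite mulr_gt0.
move=> z zP; pose w := x + (1 - c^-1)^-1 *: (z - (c^-1 *: y + (1 - c^-1) *: x)).
have Aw : A w.
  apply: xA => i; rewrite !mxE opprD addNKr normrN normrM gtr0_norm ?invr_gt0//.
  by rewrite distrC ltr_pdivrMl//; have := zP i; rewrite !mxE.
have t01 : 0 <= c^-1 <= 1 by rewrite invr_ge0 ltW//= invf_le1// ltW.
have [] := cphi _ _ _ Aw Ay t01.
suff -> : (1 - c^-1) *: w + c^-1 *: y = z by [].
have k0 : 1 - c^-1 != 0 by rewrite gt_eqF.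
rewrite /w; move: (c^-1) k0 => k k0.
by apply/rowP => i; rewrite !mxE; field.
Qed.

End convex_functions.

(** * Step functions *)

Section step_functions.
Context {R : realType} {n : nat}.
Implicit Types (p q : 'rV[R]_n * 'rV[R]_n) (x y z : 'rV[R]_n) (i j : 'I_n).
Implicit Types (c : 'rV[R]_n * 'rV[R]_n -> 'rV[R]_n * 'rV[R]_n).

(* The pair (p, a) stands for the function equal to a on [box p] and to 0
   elsewhere, and a list of pairs for a sum of such functions. *)
Definition step := seq ('rV[R]_n * 'rV[R]_n * R).
Implicit Types (s : step).

Definition step_mass s : R := \sum_(k <- s) k.2 * box_volume k.1.

Definition nondegenerate p := [forall i, p.1 0 i < p.2 0 i].

(** Stated on corners rather than as disjointness: the separating coordinate survives every cut,
    even into degenerate boxes, and tells where the next cut goes. *)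
Definition separated p q :=
  [exists i, (p.2 0 i <= q.1 0 i) || (q.2 0 i <= p.1 0 i)].

Definition step_wf s :=
  all (fun k => nondegenerate k.1 && (0 < k.2)) s &&
  pairwise (fun k l => separated k.1 l.1) s.

(** Degenerate pieces are dropped so that the length of the list, on which the induction runs,
    really decreases. *)
Definition step_cut c s : step :=
  [seq k <- [seq (c k.1, k.2) | k <- s] | nondegenerate k.1].

Lemma box_volume_gt0 p : nondegenerate p -> 0 < box_volume p.
Proof.
by move=> /forallP pp; apply: prodr_gt0 => i _; rewrite lt_max subr_gt0 pp orbT.
Qed.

Lemma box_volume_degenerate p : ~~ nondegenerate p -> box_volume p = 0.
Proof.
rewrite negb_forall => /existsP[i]; rewrite -leNgt -subr_le0 => pi.
by rewrite /box_volume (bigD1 i)//= max_l ?mul0r.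
Qed.

Lemma step_mass_cut c s :
  step_mass (step_cut c s) = \sum_(k <- s) k.2 * box_volume (c k.1).
Proof.
rewrite /step_mass /step_cut big_filter big_map big_mkcond/=.
apply: eq_bigr => k _; case: ifPn => // h.
by rewrite (box_volume_degenerate h) mulr0.
Qed.

Lemma step_mass_cutD i e s :
  step_mass (step_cut (box_cutl i e) s) + step_mass (step_cut (box_cutr i e) s) =
  step_mass s.
Proof.
rewrite !step_mass_cut -big_split/=; apply: eq_bigr => k _.
by rewrite -mulrDr box_volume_cut.
Qed.

Lemma step_wf_cut c s : (forall p q, separated p q -> separated (c p) (c q)) ->
  step_wf s -> step_wf (step_cut c s).
Proof.
move=> cS /andP[/allP sp ss]; apply/andP; split.
  apply/allP => k; rewrite mem_filter => /andP[-> /mapP[l ls ->]]/=.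
  by have /andP[] := sp _ ls.
apply: pairwise_filter; rewrite pairwise_map; apply: sub_pairwise ss.
by move=> k l; exact: cS.
Qed.

Lemma separated_cutl i e p q :
  separated p q -> separated (box_cutl i e p) (box_cutl i e q).
Proof.
move=> /existsP[j pq]; apply/existsP; exists j; rewrite /= !mxE.
case: eqP => [->{j}|//] in pq *; rewrite !ge_min.
by case/orP: pq => ->; rewrite ?orbT.
Qed.

Lemma separated_cutr i e p q :
  separated p q -> separated (box_cutr i e p) (box_cutr i e q).
Proof.
move=> /existsP[j pq]; apply/existsP; exists j; rewrite /= !mxE.
case: eqP => [->{j}|//] in pq *; rewrite !le_max.
by case/orP: pq => ->; rewrite ?orbT.
Qed.

Lemma step_mass_ge0 s : step_wf s -> 0 <= step_mass s.
Proof.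
move=> /andP[/allP sp _]; rewrite /step_mass big_seq sumr_ge0// => k ks.
by have /andP[_ k0] := sp _ ks; rewrite mulr_ge0 ?box_volume_ge0 ?ltW.
Qed.

Lemma step_mass_gt0 s : step_wf s -> (0 < step_mass s) = (s != [::]).
Proof.
case: s => [|k s]; first by rewrite /step_mass big_nil ltxx.
move=> /[dup] swf /andP[/= /andP[/andP[k1 k2] _] /andP[_ ss]].
rewrite /step_mass big_cons ltr_wpDr ?mulr_gt0 ?box_volume_gt0//.
apply: step_mass_ge0; rewrite /step_wf ss andbT.
by have /andP[/= /andP[]] := swf.
Qed.

Lemma size_step_cut c s : (size (step_cut c s) <= size s)%N.
Proof. by rewrite size_filter (leq_trans (count_size _ _))// size_map. Qed.

Lemma size_step_cut_lt c s k : k \in s -> ~~ nondegenerate (c k.1) ->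
  (size (step_cut c s) < size s)%N.
Proof.
move=> ks kc; rewrite size_filter -[ltnRHS](size_map (fun k => (c k.1, k.2)) s).
rewrite ltn_neqAle count_size andbT -all_count.
by apply/allPn; exists (c k.1, k.2) => //; exact: map_f.
Qed.

Lemma step_cut_mass_gt0 c s k : step_wf (step_cut c s) -> k \in s ->
  nondegenerate (c k.1) -> 0 < step_mass (step_cut c s).
Proof.
move=> cwf ks kc; rewrite step_mass_gt0//.
suff : (c k.1, k.2) \in step_cut c s by case: step_cut.
by rewrite mem_filter kc map_f.
Qed.

(** The hyperplane contains a face that separates the first two boxes: each side keeps one of them
    whole and loses the other. *)
Lemma step_separate s : step_wf s -> (1 < size s)%N -> exists i e,
  [/\ 0 < step_mass (step_cut (box_cutl i e) s),
      0 < step_mass (step_cut (box_cutr i e) s),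
      (size (step_cut (box_cutl i e) s) < size s)%N &
      (size (step_cut (box_cutr i e) s) < size s)%N].
Proof.
case: s => [|k [|l s]]// swf _; set s' := [:: k, l & s] in swf *.
have [ks ls] : k \in s' /\ l \in s' by rewrite !inE !eqxx orbT.
have swl i e := step_wf_cut (@separated_cutl i e) swf.
have swr i e := step_wf_cut (@separated_cutr i e) swf.
have [/= /and3P[/andP[/forallP kn _] /andP[/forallP ln _] _]] := andP swf.
move=> /andP[/= /andP[/existsP[i kl] _] _].
have cut u v : u \in s' -> v \in s' -> (forall i, u.1.1 0 i < u.1.2 0 i) ->
  (forall i, v.1.1 0 i < v.1.2 0 i) -> u.1.2 0 i <= v.1.1 0 i -> exists e,
  [/\ 0 < step_mass (step_cut (box_cutl i e) s'),
      0 < step_mass (step_cut (box_cutr i e) s'),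
      (size (step_cut (box_cutl i e) s') < size s')%N &
      (size (step_cut (box_cutr i e) s') < size s')%N].
  move=> us vs un vn uv; exists (u.1.2 0 i); split.
  - apply: (@step_cut_mass_gt0 _ _ u) => //; apply/forallP => j.
    by rewrite /= !mxE; case: eqP => [->|//]; rewrite minxx.
  - apply: (@step_cut_mass_gt0 _ _ v) => //; apply/forallP => j.
    by rewrite /= !mxE; case: eqP => [->|//]; rewrite max_l.
  - apply: (@size_step_cut_lt _ _ v) => //; rewrite negb_forall.
    apply/existsP; exists i; rewrite /= !mxE eqxx -leNgt min_r//.
    by rewrite (le_trans uv) ?ltW.
  - apply: (@size_step_cut_lt _ _ u) => //; rewrite negb_forall.
    apply/existsP; exists i; rewrite /= !mxE eqxx -leNgt max_r//.
    by rewrite ltW.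
by case/orP: kl => [kl|kl]; [have := cut k l | have := cut l k];
  move=> /(_ _ _ _ _ kl)[]// e ?; exists i, e.
Qed.

Let mass_cutl i s e := step_mass (step_cut (box_cutl i e) s).

Let mass_cutl_continuous i s : continuous (mass_cutl i s).
Proof.
have -> : mass_cutl i s =
    (fun e => \sum_(k <- s) k.2 * box_volume (box_cutl i e k.1)).
  by apply/funext => e; exact: step_mass_cut.
elim: s => [|k s IH] e.
  rewrite (_ : (fun _ => _) = cst 0); first exact: cvg_cst.
  by apply/funext => e'; rewrite big_nil.
rewrite (_ : (fun _ => _) = (fun e => k.2 * (Num.max 0 (Num.min (k.1.2 0 i) e -
    k.1.1 0 i) * \prod_(j | j != i) Num.max 0 (k.1.2 0 j - k.1.1 0 j)) +
    \sum_(k <- s) k.2 * box_volume (box_cutl i e k.1))); last first.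
  by apply/funext => e'; rewrite big_cons box_volume_cutl.
apply: cvgD; last exact: IH.
apply: cvgM; first exact: cvg_cst.
apply: cvgM; last exact: cvg_cst.
apply: (@continuous_max _ _ (cst 0) (fun e => Num.min (k.1.2 0 i) e - k.1.1 0 i)).
  exact: cvg_cst.
apply: cvgB; last exact: cvg_cst.
apply: (@continuous_min _ _ (cst (k.1.2 0 i)) id); [exact: cvg_cst|exact: cvg_id].
Qed.

(** The bound [e <= e0] keeps the cut inside the region where the strict gain is available. *)
Lemma step_mass_cutl_IVT i s e0 v :
  0 <= v <= step_mass (step_cut (box_cutl i e0) s) ->
  exists2 e, e <= e0 & step_mass (step_cut (box_cutl i e) s) = v.
Proof.
move=> /andP[v0 v1].
have [L Le L0] : exists2 L, L <= e0 & mass_cutl i s L = 0.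
  suff [L [Le LH]] : exists L, L <= e0 /\ forall k, k \in s -> L <= k.1.1 0 i.
    exists L => //; rewrite /mass_cutl step_mass_cut big_seq big1// => k ks.
    rewrite box_volume_cutl max_l ?mul0r ?mulr0// subr_le0.
    by rewrite ge_min LH// orbT.
  elim: s {v1} => [|k s [L [Le LH]]]; first by exists e0.
  exists (Num.min L (k.1.1 0 i)); rewrite ge_min Le; split=> // l.
  by rewrite inE ge_min => /predU1P[->|/LH ->//]; rewrite lexx orbT.
have [|e eI eE] := IVT (v := v) Le
  (continuous_subspaceT (@mass_cutl_continuous i s)).
  rewrite L0 ge_min v0 le_max; by rewrite /mass_cutl v1 orbT.
by exists e => //; move: eI; rewrite in_itv/= => /andP[].
Qed.

Lemma step_mass_cutl_split i s theta : step_wf s -> 0 <= theta <= 1 ->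
  exists e, step_mass (step_cut (box_cutl i e) s) = theta * step_mass s.
Proof.
move=> swf /andP[t0 t1].
have [U UH] : exists U, forall k, k \in s -> k.1.2 0 i <= U.
  elim: s {swf} => [|k s [U UH]]; first by exists 0.
  exists (Num.max U (k.1.2 0 i)) => l; rewrite inE le_max => /predU1P[->|/UH ->//].
  by rewrite lexx orbT.
have UE : step_mass (step_cut (box_cutl i U) s) = step_mass s.
  rewrite step_mass_cut /step_mass big_seq [RHS]big_seq; apply: eq_bigr => k ks.
  rewrite box_volume_cutl min_l ?UH//; congr (_ * _).
  by rewrite [RHS](bigD1 i).
have [|e _ eE] := @step_mass_cutl_IVT i s U (theta * step_mass s); last by exists e.
by rewrite UE mulr_ge0 ?step_mass_ge0//= ler_piMl ?step_mass_ge0.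
Qed.

End step_functions.

(** * The Borell-Brascamp-Lieb inequality for step functions *)

Lemma integral_halfspace (R : realType) (n : nat) (h : 'rV[R]_n -> R)
    (D : set (lebesgue_rV R n)) (i : 'I_n) (e : R) :
  (forall z, 0 <= h z) -> lebesgue_measurable_fun h -> measurable D ->
  (\int[lebesgue_measure_rV R n]_(z in D) (h z)%:E =
   \int[lebesgue_measure_rV R n]_(z in D `&` [set x | (x 0 i <= e)%R]) (h z)%:E +
   \int[lebesgue_measure_rV R n]_(z in D `&` ~` [set x | (x 0 i <= e)%R])
     (h z)%:E)%E.
Proof.
move=> h0 hm mD; rewrite -ge0_integral_setU.
- by rewrite -setIUr setUv setIT.
- exact/measurableI/measurable_halfspace.
- exact/measurableI/measurableC/measurable_halfspace.
- by apply/measurable_EFinP/measurable_funTS.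
- by move=> *; rewrite lee_fin.
- by apply/disj_setPS => z [[_ ?] [_ ?]].
Qed.

Section step_borell_brascamp_lieb.
Context {R : realType} {n : nat}.
Implicit Types (p q : 'rV[R]_n * 'rV[R]_n) (x y z : 'rV[R]_n) (i j : 'I_n).
Implicit Types (s : @step R n).
Local Notation mu := (lebesgue_measure_rV R n).
Local Notation box := (@box R n).

Variable t : R.
Hypothesis t01 : 0 < t < 1.

Let conv x y : 'rV[R]_n := (1 - t) *: x + t *: y.
Let conv_box p q := (conv p.1 q.1, conv p.2 q.2).

Let t01W : 0 <= t <= 1. Proof. by case/andP: t01 => *; rewrite !ltW. Qed.

Lemma conv_box_decomp p q z : nondegenerate p -> nondegenerate q ->
  box (conv_box p q) z -> exists x y, [/\ box p x, box q y & z = conv x y].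
Proof.
move=> /forallP pP /forallP qP zP.
pose l i := (1 - t) * (p.2 0 i - p.1 0 i) + t * (q.2 0 i - q.1 0 i).
have l0 i : 0 < l i by rewrite wsum_gt0// subr_gt0.
(* The relative position of [z] in side [i] of the combined box; [x] and [y] take the same relative
   position in [p] and [q]. *)
pose r i := (z 0 i - (conv p.1 q.1) 0 i) / l i.
have r01 i : 0 < r i <= 1.
  have := zP i; rewrite /= /r !mxE => /andP[h1 h2].
  rewrite divr_gt0 ?subr_gt0// ler_pdivrMr// mul1r /l; lra.
have bd (a b u : R) : a < b -> 0 < u <= 1 -> a < a + u * (b - a) <= b.
  move=> ab /andP[u0 u1].
  have := mulr_gt0 u0 (_ : 0 < b - a); rewrite subr_gt0 => /(_ ab).
  have := ler_wpM2r (_ : 0 <= b - a) u1; rewrite subr_ge0 => /(_ (ltW ab)); lra.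
exists (\row_i (p.1 0 i + r i * (p.2 0 i - p.1 0 i))).
exists (\row_i (q.1 0 i + r i * (q.2 0 i - q.1 0 i))); split.
- by move=> i; rewrite mxE bd.
- by move=> i; rewrite mxE bd.
- apply/rowP => i; have rl : r i * l i = z 0 i - (conv p.1 q.1) 0 i.
    by rewrite /r divfK// gt_eqF.
  move: rl; rewrite /l !mxE; lra.
Qed.

Lemma box_volume_conv p q : nondegenerate p -> nondegenerate q ->
  box_volume (conv_box p q) =
  \prod_i ((1 - t) * (p.2 0 i - p.1 0 i) + t * (q.2 0 i - q.1 0 i)).
Proof.
move=> /forallP pP /forallP qP; apply: eq_bigr => i _.
have := wsum_gt0 t01W (_ : 0 < p.2 0 i - p.1 0 i) (_ : 0 < q.2 0 i - q.1 0 i).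
rewrite !subr_gt0 => /(_ (pP i) (qP i)) h.
rewrite /= !mxE (_ : _ - _ = (1 - t) * (p.2 0 i - p.1 0 i) +
  t * (q.2 0 i - q.1 0 i)); first by rewrite max_r// ltW.
by ring.
Qed.

Lemma box_volumeE p : nondegenerate p ->
  box_volume p = \prod_i (p.2 0 i - p.1 0 i).
Proof.
by move=> /forallP pP; apply: eq_bigr => i _; rewrite max_r// subr_ge0 ltW.
Qed.

(** A family with at least two boxes is cut along a separating face, which determines [theta]; the
    other is cut by a parallel hyperplane in that proportion. The first loses a box on either side
    and the second does not grow. *)
Let step_cut_pair s s' : step_wf s -> step_wf s' -> s != [::] -> s' != [::] ->
  (2 < size s + size s')%N -> exists i e e' theta,
  [/\ 0 < theta < 1,
    step_mass (step_cut (box_cutl i e) s) = theta * step_mass s,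
    step_mass (step_cut (box_cutl i e') s') = theta * step_mass s',
    (size (step_cut (box_cutl i e) s) + size (step_cut (box_cutl i e') s') <
      size s + size s')%N &
    (size (step_cut (box_cutr i e) s) + size (step_cut (box_cutr i e') s') <
      size s + size s')%N].
Proof.
suff H s1 s2 : step_wf s1 -> step_wf s2 -> (1 < size s1)%N ->
    exists i e e' theta, [/\ 0 < theta < 1,
    step_mass (step_cut (box_cutl i e) s1) = theta * step_mass s1,
    step_mass (step_cut (box_cutl i e') s2) = theta * step_mass s2,
    (size (step_cut (box_cutl i e) s1) + size (step_cut (box_cutl i e') s2) <
      size s1 + size s2)%N &
    (size (step_cut (box_cutr i e) s1) + size (step_cut (box_cutr i e') s2) <
      size s1 + size s2)%N].
  move=> sw sw' s0 s'0 ss'; have [s1|s1] := ltnP 1 (size s); first exact: H.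
  have s'1 : (1 < size s')%N.
    rewrite ltnNge; apply: contraTN ss' => s'1; rewrite -leqNgt.
    exact: (leq_add s1 s'1).
  have [i [e [e' [theta [h1 h2 h3 h4 h5]]]]] := H _ _ sw' sw s'1.
  by exists i, e', e, theta; split=> //; rewrite addnC [ltnRHS]addnC.
move=> sw1 sw2 ss1; have [i [e [ml mr sl sr]]] := step_separate sw1 ss1.
have mD := step_mass_cutD i e s1.
have m0 : 0 < step_mass s1 by rewrite -mD addr_gt0.
pose theta := step_mass (step_cut (box_cutl i e) s1) / step_mass s1.
have theta01 : 0 < theta < 1.
  by rewrite /theta divr_gt0//= ltr_pdivrMr// mul1r -mD ltrDl.
have [|e' e'E] := step_mass_cutl_split i sw2 (_ : 0 <= theta <= 1).
  by case/andP: theta01 => *; rewrite !ltW.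
exists i, e, e', theta; split => //.
- by rewrite /theta divfK// gt_eqF.
- by rewrite -addSn leq_add// size_step_cut.
- by rewrite -addSn leq_add// size_step_cut.
Qed.

(** [m] and [M] are the means of heights and of masses. They are kept abstract so that the result
    also applies to [K * m] and [K * M]. The set [D] confines the integral to one side of the cuts
    already made. *)
Lemma step_borell_brascamp_lieb (m M : R -> R -> R) (h : 'rV[R]_n -> R) :
  (forall a b : R, 0 < a -> 0 < b -> 0 <= m a b) ->
  (forall (a b : R) (u v : 'I_n -> R), 0 < a -> 0 < b ->
    (forall i, 0 < u i) -> (forall i, 0 < v i) ->
    M (a * \prod_i u i) (b * \prod_i v i) <=
    m a b * \prod_i ((1 - t) * u i + t * v i)) ->
  (forall k a b : R, 0 < k -> 0 < a -> 0 < b -> M (k * a) (k * b) = k * M a b) ->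
  (forall z, 0 <= h z) -> lebesgue_measurable_fun h ->
  forall s s' (D : set (lebesgue_rV R n)), step_wf s -> step_wf s' ->
  s != [::] -> s' != [::] -> measurable D ->
  (forall k l x y, k \in s -> l \in s' -> box k.1 x -> box l.1 y ->
    D (conv x y) /\ m k.2 l.2 <= h (conv x y)) ->
  ((M (step_mass s) (step_mass s'))%:E <= \int[mu]_(z in D) (h z)%:E)%E.
Proof.
move=> m0 mM MZ h0 hm s s'.
have [N] := ubnP (size s + size s'); elim: N s s' => // N IH s s'.
rewrite ltnS => sN D sw sw' s0 s'0 mD hD.
have [ss'|] := ltnP 2 (size s + size s'); last first.
  move=> ss'; have [k [l [sE s'E]]] : exists k l, s = [:: k] /\ s' = [:: l].
    move: s0 s'0 ss'; case: (s) (s') => [|k [|? ?]] [|l [|? ?]]//= _ _.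
    - by exists k, l.
    - by rewrite ?addnS ?addSn.
    - by rewrite ?addnS ?addSn.
  subst s s'.
  have [/= /andP[/andP[kn k0] _] _] := andP sw.
  have [/= /andP[/andP[ln l0] _] _] := andP sw'.
  rewrite /step_mass !big_seq1 !box_volumeE//.
  have cD : box (conv_box k.1 l.1) `<=` D.
    move=> z /(conv_box_decomp kn ln)[x [y [kx ly ->]]].
    by have [] := hD k l x y; rewrite ?mem_seq1.
  apply: (@le_trans _ _ (\int[mu]_(z in box (conv_box k.1 l.1)) (h z)%:E)%E);
    last first.
    apply: ge0_subset_integral.
    - exact: measurable_box.
    - exact: mD.
    - exact/measurable_EFinP/measurable_funTS.
    - by move=> *; rewrite lee_fin.
    - exact: cD.
  apply: (@le_trans _ _ (\int[mu]_(z in box (conv_box k.1 l.1)) (m k.2 l.2)%:E)%E);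
    last first.
    apply: ge0_le_integral.
    - exact: measurable_box.
    - by move=> *; rewrite lee_fin m0.
    - exact: measurable_cst.
    - exact/measurable_EFinP/measurable_funTS.
    - move=> z /(conv_box_decomp kn ln)[x [y [kx ly ->]]].
      by have [] := hD k l x y; rewrite ?mem_seq1// lee_fin.
  rewrite integral_cst; last exact: measurable_box.
  rewrite [X in (_ <= _ * X)%E]lebesgue_measure_box lee_fin box_volume_conv//.
  by apply: mM => // i; rewrite subr_gt0; [move/forallP : kn|move/forallP : ln].
have [i [e [e' [theta [th mE mE' sl sr]]]]] := step_cut_pair sw sw' s0 s'0 ss'.
have [th0 th1] := andP th.
have [M0 M'0] : 0 < step_mass s /\ 0 < step_mass s' by rewrite !step_mass_gt0.
have mr : step_mass (step_cut (box_cutr i e) s) = (1 - theta) * step_mass s.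
  by have := step_mass_cutD i e s; rewrite mE; lra.
have mr' : step_mass (step_cut (box_cutr i e') s') = (1 - theta) * step_mass s'.
  by have := step_mass_cutD i e' s'; rewrite mE'; lra.
(* The families are cut at different places [e] and [e'], but combinations of points left of both
   land left of this hyperplane, and likewise on the right; so the two halves use disjoint parts of
   the integral. *)
rewrite (integral_halfspace i ((1 - t) * e + t * e'))//.
have -> : M (step_mass s) (step_mass s') =
    M (theta * step_mass s) (theta * step_mass s') +
    M ((1 - theta) * step_mass s) ((1 - theta) * step_mass s').
  by rewrite !MZ ?subr_gt0// -mulrDl addrC subrK mul1r.
rewrite EFinD -mE -mE' -mr -mr'; apply: leeD.
- have swl := step_wf_cut (@separated_cutl R n i e) sw.
  have swl' := step_wf_cut (@separated_cutl R n i e') sw'.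
  apply: IH => //.
  + exact: leq_trans sl sN.
  + by rewrite -step_mass_gt0// mE mulr_gt0.
  + by rewrite -step_mass_gt0// mE' mulr_gt0.
  + exact/measurableI/measurable_halfspace.
  move=> k l x y; rewrite !mem_filter => /andP[_ /mapP[k1 ks ->]].
  move=> /andP[_ /mapP[l1 ls ->]]; rewrite !box_cutlE => -[kx xe] [ly ye].
  have [Dz mh] := hD _ _ _ _ ks ls kx ly; split => //; split => //.
  by rewrite /= !mxE; exact: wsum_le.
- have swr := step_wf_cut (@separated_cutr R n i e) sw.
  have swr' := step_wf_cut (@separated_cutr R n i e') sw'.
  apply: IH => //.
  + exact: leq_trans sr sN.
  + by rewrite -step_mass_gt0// mr mulr_gt0// subr_gt0.
  + by rewrite -step_mass_gt0// mr' mulr_gt0// subr_gt0.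
  + exact/measurableI/measurableC/measurable_halfspace.
  move=> k l x y; rewrite !mem_filter => /andP[_ /mapP[k1 ks ->]].
  move=> /andP[_ /mapP[l1 ls ->]]; rewrite !box_cutrE => -[kx xe] [ly ye].
  have [Dz mh] := hD _ _ _ _ ks ls kx ly; split => //; split => //.
  rewrite /= !mxE; apply/negP; rewrite -ltNge -subr_gt0.
  have := wsum_gt0 t01W (_ : 0 < x 0 i - e) (_ : 0 < y 0 i - e').
  by rewrite !subr_gt0 => /(_ xe ye); lra.
Qed.

(** The left pieces, a proportion [theta] of both masses, gain the factor [K] while the right pieces
    keep the factor 1; homogeneity of [M] adds them up. *)
Lemma step_borell_brascamp_lieb_gain (m M : R -> R -> R) (h : 'rV[R]_n -> R)
    (K theta : R) i e0 s s' : 0 <= K -> 0 < theta < 1 ->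
  (forall a b : R, 0 < a -> 0 < b -> 0 <= m a b) ->
  (forall (a b : R) (u v : 'I_n -> R), 0 < a -> 0 < b ->
    (forall i, 0 < u i) -> (forall i, 0 < v i) ->
    M (a * \prod_i u i) (b * \prod_i v i) <=
    m a b * \prod_i ((1 - t) * u i + t * v i)) ->
  (forall k a b : R, 0 < k -> 0 < a -> 0 < b -> M (k * a) (k * b) = k * M a b) ->
  (forall z, 0 <= h z) -> lebesgue_measurable_fun h ->
  step_wf s -> step_wf s' -> s != [::] -> s' != [::] ->
  theta * step_mass s <= step_mass (step_cut (box_cutl i e0) s) ->
  theta * step_mass s' <= step_mass (step_cut (box_cutl i e0) s') ->
  (forall k l x y, k \in s -> l \in s' -> box k.1 x -> box l.1 y ->
    m k.2 l.2 <= h (conv x y) /\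
    (x 0 i <= e0 -> y 0 i <= e0 -> K * m k.2 l.2 <= h (conv x y))) ->
  (((1 - theta + theta * K) * M (step_mass s) (step_mass s'))%:E <=
    \int[mu]_z (h z)%:E)%E.
Proof.
move=> K0 /andP[th0 th1] m0 mM MZ h0 hm sw sw' s0 s'0 ms ms' mh.
have [M0 M'0] : 0 < step_mass s /\ 0 < step_mass s' by rewrite !step_mass_gt0.
have [e ee mE] : exists2 e, e <= e0 &
    step_mass (step_cut (box_cutl i e) s) = theta * step_mass s.
  by apply: step_mass_cutl_IVT; rewrite ms mulr_ge0 ?(ltW th0) ?(ltW M0).
have [e' ee' mE'] : exists2 e, e <= e0 &
    step_mass (step_cut (box_cutl i e) s') = theta * step_mass s'.
  by apply: step_mass_cutl_IVT; rewrite ms' mulr_ge0 ?(ltW th0) ?(ltW M'0).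
have mr : step_mass (step_cut (box_cutr i e) s) = (1 - theta) * step_mass s.
  by have := step_mass_cutD i e s; rewrite mE; lra.
have mr' : step_mass (step_cut (box_cutr i e') s') = (1 - theta) * step_mass s'.
  by have := step_mass_cutD i e' s'; rewrite mE'; lra.
rewrite (integral_halfspace i ((1 - t) * e + t * e'))// !setTI.
have -> : (1 - theta + theta * K) * M (step_mass s) (step_mass s') =
    K * M (theta * step_mass s) (theta * step_mass s') +
    M ((1 - theta) * step_mass s) ((1 - theta) * step_mass s').
  by rewrite !MZ ?subr_gt0//; ring.
rewrite EFinD -mE -mE' -mr -mr'; apply: leeD.
- have swl := step_wf_cut (@separated_cutl R n i e) sw.
  have swl' := step_wf_cut (@separated_cutl R n i e') sw'.
  apply: (@step_borell_brascamp_lieb (fun a b => K * m a b)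
    (fun a b => K * M a b)) => //.
  + by move=> a b a0 b0; rewrite mulr_ge0// m0.
  + by move=> *; rewrite -mulrA ler_wpM2l// mM.
  + by move=> *; rewrite MZ// mulrCA.
  + by rewrite -step_mass_gt0// mE mulr_gt0.
  + by rewrite -step_mass_gt0// mE' mulr_gt0.
  + exact: measurable_halfspace.
  move=> k l x y; rewrite !mem_filter => /andP[_ /mapP[k1 ks ->]].
  move=> /andP[_ /mapP[l1 ls ->]]; rewrite !box_cutlE => -[kx xe] [ly ye].
  have [_ mKh] := mh _ _ _ _ ks ls kx ly; split.
    by rewrite /= !mxE; exact: wsum_le.
  by apply: mKh; [exact: le_trans ee|exact: le_trans ee'].
- have swr := step_wf_cut (@separated_cutr R n i e) sw.
  have swr' := step_wf_cut (@separated_cutr R n i e') sw'.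
  apply: (@step_borell_brascamp_lieb m M) => //.
  + by rewrite -step_mass_gt0// mr mulr_gt0// subr_gt0.
  + by rewrite -step_mass_gt0// mr' mulr_gt0// subr_gt0.
  + exact/measurableC/measurable_halfspace.
  move=> k l x y; rewrite !mem_filter => /andP[_ /mapP[k1 ks ->]].
  move=> /andP[_ /mapP[l1 ls ->]]; rewrite !box_cutrE => -[kx xe] [ly ye].
  have [mh' _] := mh _ _ _ _ ks ls kx ly; split => //.
  rewrite /= !mxE; apply/negP; rewrite -ltNge -subr_gt0.
  have := wsum_gt0 t01W (_ : 0 < x 0 i - e) (_ : 0 < y 0 i - e').
  by rewrite !subr_gt0 => /(_ xe ye); lra.
Qed.

End step_borell_brascamp_lieb.

(** * Approximation from below by step functions *)

Section approximation.
Context {R : realType} {n : nat}.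
Implicit Types (p q : 'rV[R]_n * 'rV[R]_n) (x y z : 'rV[R]_n) (i j : 'I_n).
Implicit Types (s : @step R n) (u : 'rV[R]_n -> R) (D O : set 'rV[R]_n).
Local Notation mu := (lebesgue_measure_rV R n).
Local Notation box := (@box R n).

Lemma separated_disjoint p q : separated p q -> [disjoint box p & box q].
Proof.
move=> /existsP[i pq]; apply/disj_setPS => x [/(_ i) xp /(_ i) xq].
by move: pq xp xq; case/orP => [h|h] /andP[h1 h2] /andP[h3 h4]; exfalso; lra.
Qed.

Lemma step_mass_le_integral s u (D : set (lebesgue_rV R n)) :
  (forall x, 0 <= u x) ->
  lebesgue_measurable_fun u -> measurable D -> step_wf s ->
  (forall k x, k \in s -> box k.1 x -> D x /\ k.2 <= u x) ->
  ((step_mass s)%:E <= \int[mu]_(x in D) (u x)%:E)%E.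
Proof.
move=> u0 um; elim: s D => [|k s IH] D mD sw sD.
  by rewrite /step_mass big_nil; apply: integral_ge0 => x _; rewrite lee_fin.
have [/= /andP[/andP[kn k0] sa] /andP[/allP ks sp]] := andP sw.
have kD : box k.1 `<=` D by move=> x kx; have [] := sD k x; rewrite ?inE ?eqxx.
have mb := measurable_box k.1.
rewrite /step_mass big_cons EFinD -(setDUK kD) ge0_integral_setU; first last.
- by rewrite disj_set2E setDIK.
- by move=> *; rewrite lee_fin.
- by apply/measurable_EFinP/measurable_funTS.
- exact: measurableD.
- exact: mb.
apply: leeD.
  apply: (@le_trans _ _ (\int[mu]_(x in box k.1) (k.2)%:E)%E).
    rewrite integral_cst; last exact: mb.
    by rewrite [X in (_ <= _ * X)%E]lebesgue_measure_box EFinM.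
  apply: ge0_le_integral.
  - exact: mb.
  - by move=> *; rewrite lee_fin ltW.
  - exact: measurable_cst.
  - exact/measurable_EFinP/measurable_funTS.
  - by move=> x kx; have [] := sD k x; rewrite ?inE ?eqxx// lee_fin.
apply: IH; first exact: measurableD.
  by rewrite /step_wf sa sp.
move=> l x ls lx; have [|//|Dx lu] := sD l x; first by rewrite inE ls orbT.
split=> //; split=> // kx.
by have /disj_setPS /(_ x) := separated_disjoint (ks _ ls); apply.
Qed.

Let step_fun s x : R := \sum_(k <- s) k.2 * \1_(box k.1) x.

Let step_fun_ge0 s x : step_wf s -> 0 <= step_fun s x.
Proof.
move=> /andP[/allP sa _]; rewrite /step_fun big_seq sumr_ge0// => k /sa/andP[_ k0].
by rewrite mulr_ge0// ltW.
Qed.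

Let step_fun_ge s k x : step_wf s -> k \in s -> box k.1 x -> k.2 <= step_fun s x.
Proof.
move=> /andP[/allP sa _] ks kx; rewrite /step_fun (big_rem k)//=.
rewrite indicE mem_set// mulr1 lerDl big_seq sumr_ge0// => l /mem_rem/sa/andP[_ l0].
by rewrite mulr_ge0// ltW.
Qed.

Let step_fun_measurable s : measurable_fun [set: lebesgue_rV R n] (step_fun s).
Proof.
apply: measurable_sum => k; apply: measurable_funM; first exact: measurable_cst.
by apply: measurable_indic; exact: measurable_box.
Qed.

Let integral_step_fun s (D : set (lebesgue_rV R n)) : measurable D -> step_wf s ->
  (\int[mu]_(x in D) (step_fun s x)%:E <= (step_mass s)%:E)%E.
Proof.
move=> mD sw.
apply: (@le_trans _ _ (\int[mu]_x (step_fun s x)%:E)%E).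
  apply: ge0_subset_integral; [exact: mD|exact: measurableT|..].
  - exact/measurable_EFinP/step_fun_measurable.
  - by move=> x _; rewrite lee_fin step_fun_ge0.
  - exact: subsetT.
have sa : forall k, k \in s -> 0 <= k.2.
  by move=> k ks; have /andP[/allP/(_ _ ks)/andP[_ /ltW]] := sw.
rewrite /step_fun /step_mass {sw}; elim: s sa => [|k s IH] sa.
  under eq_integral do rewrite big_nil.
  by rewrite integral0 big_nil.
under eq_integral do rewrite big_cons EFinD.
have k0 : 0 <= k.2 by apply: sa; rewrite inE eqxx.
have sa' l : l \in s -> 0 <= l.2 by move=> ls; apply: sa; rewrite inE ls orbT.
rewrite ge0_integralD; first last.
- exact/measurable_EFinP/step_fun_measurable.
- by move=> x _; rewrite lee_fin big_seq sumr_ge0// => l /sa' l0; rewrite mulr_ge0.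
- apply/measurable_EFinP/measurable_funM; first exact: measurable_cst.
  by apply: measurable_indic; exact: measurable_box.
- by move=> x _; rewrite lee_fin mulr_ge0.
- exact: measurableT.
rewrite big_cons EFinD; apply: leeD; last exact: IH.
under eq_integral do rewrite EFinM.
rewrite ge0_integralZl; first last.
- by rewrite lee_fin.
- by move=> x _; rewrite lee_fin.
- by apply/measurable_EFinP/measurable_indic; exact: measurable_box.
- exact: measurableT.
rewrite integral_indic; [|exact: measurableT|exact: measurable_box].
by rewrite setIT [X in (_ * X <= _)%E]lebesgue_measure_box EFinM.
Qed.

Lemma ubound_limn_einf (v : (\bar R)^nat) (a : \bar R) :
  (forall m, v m <= a)%E -> (limn_einf v <= a)%E.
Proof.
move=> va; rewrite limn_einf_lim; apply: lime_le; first exact: is_cvg_einfs.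
apply: nearW => m; apply: le_trans (va m).
by apply: ereal_inf_lbound; exists m => /=.
Qed.

Lemma lbound_limn_einf (v : (\bar R)^nat) (a : \bar R) :
  (\forall m \near \oo, a <= v m)%E -> (a <= limn_einf v)%E.
Proof.
move=> [N _ Nv]; rewrite limn_einf_lim; apply: lime_ge; first exact: is_cvg_einfs.
exists N => // m /= Nm; apply: le_ereal_inf_tmp => _ [k /= mk <-].
exact/Nv/(leq_trans Nm).
Qed.

Section grid.
Variables (O : set 'rV[R]_n) (u : 'rV[R]_n -> R) (N m : nat).
Hypotheses (u0 : forall x, 0 <= u x).

Let index := {ffun 'I_n -> 'I_(N.*2 * m.+1)}.

(** Cells of side [1 / m.+1] tiling the cube of half-side [N] around the origin, hence [N.*2 * m.+1]
    of them in each direction. *)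
Let cell (k : index) : 'rV[R]_n * 'rV[R]_n :=
  (\row_i (- N%:R + (k i)%:R / m.+1%:R), \row_i (- N%:R + (k i).+1%:R / m.+1%:R)).

Let height (k : index) : R :=
  if `[<box (cell k) `<=` O>] then inf (u @` box (cell k)) else 0.

Definition grid_step : @step R n :=
  [seq (cell k, height k) | k <- enum {: index} & 0 < height k].

Let cell_nondegenerate k : nondegenerate (cell k).
Proof.
apply/forallP => i; rewrite !mxE ltrD2l ltr_pM2r ?invr_gt0 ?ltr0n//.
by rewrite ltr_nat.
Qed.

Lemma grid_step_wf : step_wf grid_step.
Proof.
apply/andP; split.
  apply/allP => _ /mapP[k + ->] /=.
  by rewrite mem_filter cell_nondegenerate => /andP[].
rewrite pairwise_map; apply: pairwise_filter.
have := enum_uniq {: index}; rewrite uniq_pairwise; apply: sub_pairwise => k l /= kl.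
have /existsP[i kli] : [exists i, k i != l i].
  apply: contraNT kl; rewrite negb_exists => /forallP kl; apply/eqP/ffunP => i.
  by apply/eqP; have := kl i; rewrite negbK.
apply/existsP; exists i; rewrite /= !mxE !lerD2l !ler_pM2r ?invr_gt0 ?ltr0n//.
rewrite !ler_nat; move: kli; rewrite -val_eqE/= neq_ltn => /orP[] ->//.
by rewrite orbT.
Qed.

Let height_le k x : box (cell k) x -> 0 < height k -> O x /\ height k <= u x.
Proof.
rewrite /height; case: asboolP => [kO|_]; last by rewrite ltxx.
move=> kx _; split; first exact: kO.
by apply: ge_inf; [exists 0 => _ [y _ <-]; exact: u0|exists x].
Qed.

Lemma grid_step_le k x : k \in grid_step -> box k.1 x -> O x /\ k.2 <= u x.
Proof.
move=> /mapP[l + ->] /= lx; rewrite mem_filter => /andP[l0 _].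
exact: height_le.
Qed.

Lemma grid_step_near (x : 'rV[R]_n) (a : R) : 0 < a ->
  (forall i, `|x 0 i| < N%:R) ->
  (forall y, (forall i, `|x 0 i - y 0 i| <= m.+1%:R^-1) -> O y /\ a <= u y) ->
  exists2 k, k \in grid_step & box k.1 x /\ a <= k.2.
Proof.
move=> a0 xN xa; have m0 : 0 < m.+1%:R :> R by rewrite ltr0n.
have /choice[k kP] : forall i, exists k : 'I_(N.*2 * m.+1),
    - N%:R + k%:R / m.+1%:R < x 0 i <= - N%:R + k.+1%:R / m.+1%:R.
  move=> i; have := xN i; rewrite ltr_norml => /andP[xl xr].
  (* The coordinate counted from [- N] in units of the mesh. Cells are open on the left and closed
     on the right, so the index is the least [k] with [v <= k.+1]. *)
  pose v := (x 0 i + N%:R) * m.+1%:R.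
  have v0 : 0 < v by rewrite mulr_gt0//; lra.
  have ex : exists k, (v <= k.+1%:R)%R.
    by exists (Num.truncn v); exact/ltW/truncnS_gt.
  case: (ex_minnP ex) => k kv kmin.
  have vk : k%:R < v.
    case: k kv kmin => [//|k] _ kmin; rewrite ltNge; apply/negP => /kmin.
    by rewrite ltnn.
  have kN : (k < N.*2 * m.+1)%N.
    rewrite -(ltr_nat R) (lt_trans vk)// /v natrM ltr_pM2r// -addnn natrD; lra.
  have E (w : R) : - N%:R + w / m.+1%:R < x 0 i = (w < v).
    by rewrite -ltrBrDl opprK ltr_pdivrMr.
  have E' (w : R) : x 0 i <= - N%:R + w / m.+1%:R = (v <= w).
    by rewrite -lerBlDl opprK ler_pdivlMr.
  by exists (Ordinal kN); rewrite E E' vk.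
have kx : box (cell (finfun k)) x.
  by move=> i; rewrite !mxE ffunE; exact: kP.
have near y : box (cell (finfun k)) y -> forall i, `|x 0 i - y 0 i| <= m.+1%:R^-1.
  move=> ky i; have := kx i; have := ky i; rewrite !mxE ffunE.
  rewrite -[(k i).+1%:R]natr1 mulrDl mul1r ler_norml.
  set v := (k i)%:R / m.+1%:R; set w := m.+1%:R^-1.
  by move: v w => v w /andP[h1 h2] /andP[h3 h4]; lra.
have ah : a <= height (finfun k).
  rewrite /height; case: asboolP => [kO|[]]; last by move=> y /near/xa[].
  apply: lb_le_inf; first by exists (u x), x.
  by move=> _ [y /near/xa[_ ay] <-].
exists (cell (finfun k), height (finfun k)) => //.
by apply/mapP; exists (finfun k) => //; rewrite mem_filter mem_enum (lt_le_trans a0).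
Qed.

End grid.

(** By continuity the lower limit of the grid step functions is at least [u] on [O]; if all their
    masses were at most [c], so would be the integral. The grids are not nested, hence Fatou's lemma
    rather than monotone convergence. *)
Lemma step_approximation O u (c : R) : open O -> bounded_set O ->
  (forall x, 0 <= u x) -> lebesgue_measurable_fun u ->
  (forall x, O x -> {for x, continuous u}) ->
  (c%:E < \int[mu]_(x in O) (u x)%:E)%E ->
  exists s, [/\ step_wf s, forall k x, k \in s -> box k.1 x -> O x /\ k.2 <= u x &
    c < step_mass s].
Proof.
move=> oO [M [_ /(_ (M + 1)) OM]] u0 um uc cI.
have {}OM x : O x -> `|x| <= M + 1 by apply: OM; rewrite ltrDl.
have mO : measurable (O : set (lebesgue_rV R n)) by exact: open_lebesgue_measurable.
pose N := (Num.truncn (M + 1)).+1.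
have ON x i : O x -> `|x 0 i| < N%:R.
  move=> Ox; apply: le_lt_trans (coord_le_norm _ _) _.
  by apply: le_lt_trans (OM _ Ox) _; exact: truncnS_gt.
pose S m := grid_step O u N m.
have Swf m : step_wf (S m) by exact: grid_step_wf.
have SO m k x : k \in S m -> box k.1 x -> O x /\ k.2 <= u x.
  exact: grid_step_le.
apply: contrapT => /forallNP H.
have {}H m : step_mass (S m) <= c.
  by rewrite leNgt; apply/negP => cS; apply: (H (S m)); split => //; exact: SO.
move: cI; apply/negP; rewrite -leNgt.
have limS x : O x ->
    ((u x)%:E <= limn_einf (fun m => (step_fun (S m) x)%:E))%E.
  move=> Ox; apply/lee_subgt0Pr => e e0; rewrite -EFinB.
  apply: lbound_limn_einf; have [ue|ue] := leP (u x - e) 0.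
    by apply: nearW => m; rewrite lee_fin (le_trans ue)// step_fun_ge0.
  have /cvgrPdist_le/(_ _ e0) xe := uc _ Ox.
  have : nbhs x (O `&` [set y | `|u x - u y| <= e]).
    by apply: filterI; [exact: open_nbhs_nbhs|exact: xe].
  move=> /nbhs_rVP[d d0 dP].
  exists (Num.truncn d^-1).+1 => // m /= dm.
  have [y xy|k kS [kx ak]] := @grid_step_near O u N m x _ ue (ON x ^~ Ox).
    have [i|Oy uy] := dP y.
      apply: le_lt_trans (xy i) _; rewrite invf_plt ?posrE ?ltr0n//.
      by apply: lt_trans (truncnS_gt _) _; rewrite ltr_nat.
    by split=> //; move: uy; rewrite /= ler_norml; lra.
  by rewrite lee_fin (le_trans ak)//; exact: step_fun_ge.
have mS m : measurable_fun (O : set (lebesgue_rV R n)) (EFin \o step_fun (S m)).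
  by apply/measurable_EFinP/measurable_funTS; exact: step_fun_measurable.
apply: (@le_trans _ _ (\int[mu]_(x in O)
    limn_einf (fun m => (step_fun (S m) x)%:E))%E).
  apply: ge0_le_integral; [exact: mO|..].
  - by move=> x _; rewrite lee_fin.
  - exact/measurable_EFinP/measurable_funTS.
  - apply: measurableT_comp; first exact: oppe_measurable.
    apply: measurable_fun_limn_esup => m.
    by apply: measurableT_comp; [exact: oppe_measurable|exact: mS].
  - exact: limS.
apply: le_trans; first apply: fatou.
- exact: mO.
- exact: mS.
- by move=> m x _; rewrite lee_fin step_fun_ge0.
apply: ubound_limn_einf => m; apply: le_trans (integral_step_fun mO (Swf m)) _.
by rewrite lee_fin.
Qed.

End approximation.

(** * Strictly power concave functions *)

Lemma continuous_powR_comp (R : realType) (T : topologicalType) (h : T -> R)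
    (r : R) (x : T) :
  {for x, continuous h} -> 0 < h x -> {for x, continuous (fun z => h z `^ r)}.
Proof.
move=> hx hx0; rewrite /prop_for/= /continuous_at.
have -> : h x `^ r = expR (r * ln (h x)) by rewrite /powR gt_eqF.
apply: (@cvg_trans _ ((fun z => expR (r * ln (h z))) @ x)).
  apply: near_eq_cvg; near=> z; rewrite /powR gt_eqF//.
  by near: z; exact: (cvgr_gt _ hx).
apply: continuous_cvg; first exact: continuous_expR.
apply: cvgM; first exact: cvg_cst.
by apply: continuous_cvg => //; exact: continuous_ln.
Unshelve. all: by end_near. Qed.

Section strictly_concave_functions.
Context {R : realType} {n : nat}.
Implicit Types (f g : 'rV[R]_n -> R) (x y z : 'rV[R]_n) (t : R).

Section strict.
Variables (f : 'rV[R]_n -> R) (p : R).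
Hypotheses (n_gt0 : (0 < n)%N) (fp : strictly_power_concave p%:E f).

Let unit_vec : 'rV[R]_n := const_mx 1.

Let unit_vec_neq0 : unit_vec != 0.
Proof.
apply/eqP => /rowP/(_ (Ordinal n_gt0)); rewrite !mxE => /eqP.
by rewrite oner_eq0.
Qed.

(** If [f x = 0], every mean with [f x] vanishes. The equality required at [t = 0] then makes [f]
    vanish identically, which gives a forbidden equality at the midpoint of two distinct points. *)
Lemma strictly_power_concave_gt0 x : 0 < f x.
Proof.
have [[f0 _] fs] := fp; rewrite lt_neqAle f0 andbT eq_sym; apply/eqP => fx.
pose y := x + unit_vec; have xy : y <> x.
  by move=> /eqP; rewrite /y -subr_eq0 addrC addKr (negbTE unit_vec_neq0).
have pm0 z t : power_mean p%:E (f z) (f x) t = 0.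
  by rewrite /power_mean fx mulr0 eqxx.
have zero z : f z = 0.
  have t00 : 0 <= (0 : R) <= 1 by rewrite lexx ler01.
  have [_ /(_ (Or32 _ _ erefl))] := fs z x 0 t00 (or_introl erefl).
  by rewrite pm0 subr0 scale1r scale0r addr0.
have t01 : 0 <= (2^-1 : R) <= 1 by rewrite invr_ge0 ler0n invf_le1// ler1n.
have [] := fs y x 2^-1 t01 (or_introl erefl).
rewrite pm0 zero => /(_ erefl)[//|h|h] _.
  by move: (lt0r_neq0 (ltr0n R 2)); rewrite -invr_eq0 h eqxx.
by lra.
Qed.

Lemma strictly_power_concave_lt x y t : x <> y -> 0 < t < 1 ->
  pmean p%:E (f x) (f y) t < f ((1 - t) *: x + t *: y).
Proof.
move=> xy t01; have [[_ fc] fs] := fp; have [t0 t1] := andP t01.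
have t01' : 0 <= t <= 1 by rewrite !ltW.
rewrite pmeanE lt_neqAle fc// andbT eq_sym; apply/eqP => h.
have [/(_ h) + _] := fs x y t t01' (or_introl erefl).
by case=> e; [exact: xy|rewrite e ltxx in t0|rewrite e ltxx in t1].
Qed.

Lemma strictly_power_concave_le x y t : 0 <= t <= 1 ->
  pmean p%:E (f x) (f y) t <= f ((1 - t) *: x + t *: y).
Proof. by rewrite pmeanE; have [[_ +] _] := fp; apply. Qed.

Let strict_powR x y t : 0 < p -> x <> y -> 0 < t < 1 ->
  (1 - t) * f x `^ p + t * f y `^ p < f ((1 - t) *: x + t *: y) `^ p.
Proof.
move=> p0 xy t01; have f0 := strictly_power_concave_gt0.
have t01' : 0 <= t <= 1 by case/andP: t01 => *; rewrite !ltW.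
have := strictly_power_concave_lt xy t01.
rewrite (pmean_pos _ _ (f0 x) (f0 y)) (gt_eqF p0).
set v := _ + _ => h; have v0 : 0 < v by rewrite wsum_gt0// powR_gt0.
rewrite -[ltLHS](@powRKV _ p) ?gt_eqF ?ltW//.
by apply: gt0_ltr_powR; rewrite ?nnegrE ?powR_ge0// ltW.
Qed.

(** For [p > 0] the function [psi] is positive and strictly concave on the whole space. It takes two
    different values, and beyond the smaller one, on the line through both points, it would become
    negative. *)
Lemma strictly_power_concave_exponent_le0 : p <= 0.
Proof.
rewrite leNgt; apply/negP => p0.
pose psi z := f z `^ p.
have psi0 z : 0 < psi z by rewrite powR_gt0// strictly_power_concave_gt0.
have u0 := unit_vec_neq0.
have [a ab] : exists a, psi a < psi unit_vec.
  have h0 : 0 <> 2 *: unit_vec.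
    by move=> /esym/eqP; rewrite scaler_eq0 (negbTE u0) pnatr_eq0.
  have t01 : 0 < (2^-1 : R) < 1 by lra.
  have := strict_powR p0 h0 t01.
  have -> : (1 - 2^-1) *: 0 + 2^-1 *: (2 *: unit_vec) = unit_vec.
    by rewrite scaler0 add0r scalerA mulVf ?scale1r// pnatr_eq0.
  rewrite -/(psi _) -/(psi _) -/(psi _).
  have [?|h1] := ltP (psi 0) (psi unit_vec); first by exists 0.
  have [?|h2] := ltP (psi (2 *: unit_vec)) (psi unit_vec).
    by exists (2 *: unit_vec).
  by lra.
(* Chosen so that [(1 - s) * psi b = psi a]; as [a] is the point [(1 - s) *: b + s *: w], strict
   concavity leaves [psi w < 0]. *)
set b := unit_vec in ab; pose s := 1 - psi a / psi b.
have s0 : 0 < s by rewrite subr_gt0 ltr_pdivrMr// mul1r.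
have s1 : s < 1 by rewrite /s gtrBl divr_gt0.
have anb : a <> b by move=> e; rewrite e ltxx in ab.
pose w := b + s^-1 *: (a - b).
have bw : b <> w.
  move=> /eqP; rewrite /w -subr_eq0 opprD addNKr oppr_eq0 scaler_eq0 invr_eq0.
  by rewrite gt_eqF//= subr_eq0 => /eqP.
have s01 : 0 < s < 1 by rewrite s0.
have := strict_powR p0 bw s01; rewrite -/(psi _) -/(psi _) -/(psi _).
have -> : (1 - s) *: b + s *: w = a.
  by apply/rowP => i; rewrite !mxE; field; rewrite gt_eqF.
have -> : (1 - s) * psi b = psi a by rewrite /s opprB addrC subrK divfK ?gt_eqF.
by have := mulr_gt0 s0 (psi0 w); lra.
Qed.

(** [- ln f] for [p = 0], and the power of [f] with exponent [p] for [p < 0], are convex on the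
    whole space, where every point is interior. *)
Lemma strictly_power_concave_continuous : continuous f.
Proof.
have f0 := strictly_power_concave_gt0.
have iT z : interior [set: 'rV[R]_n] z by rewrite interiorT.
have := strictly_power_concave_exponent_le0.
rewrite le_eqVlt => /predU1P[p0|p0] x.
  have fE : f = (fun z => expR (- - ln (f z))).
    by apply/funext => z; rewrite opprK lnK ?posrE.
  suff lnc : {for x, continuous (fun z => - ln (f z))}.
    suff : {for x, continuous (fun z => expR (- - ln (f z)))} by rewrite -fE.
    apply: (@continuous_comp _ _ _ (fun z => - - ln (f z)) expR).
      by move: lnc => /cvgN.
    exact: continuous_expR.
  apply: (@convex_on_continuous _ _ setT) => // u v t _ _ t01; split => //.
  have := strictly_power_concave_le u v t01.
  rewrite (pmean_pos _ _ (f0 u) (f0 v)) p0 eqxx.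
  rewrite -ler_ln ?posrE ?mulr_gt0 ?powR_gt0// lnM ?posrE ?powR_gt0// !ln_powR.
  by lra.
have fE : f = (fun z => (f z `^ p) `^ p^-1).
  by apply/funext => z; rewrite powRVK ?lt_eqF// ltW.
suff : {for x, continuous (fun z => (f z `^ p) `^ p^-1)} by rewrite -fE.
apply: continuous_powR_comp; last first.
  exact: powR_gt0.
apply: (@convex_on_continuous _ _ setT) => // u v t _ _ t01; split => //.
have := strictly_power_concave_le u v t01.
rewrite (pmean_pos _ _ (f0 u) (f0 v)) lt_eqF//.
set w := (1 - t) * f u `^ p + t * f v `^ p => h.
have w0 : 0 < w by rewrite wsum_gt0// powR_gt0.
rewrite -[leRHS](@powRKV _ p) ?lt_eqF ?(ltW w0)//.
by apply: le0_ler_powR; rewrite ?powR_gt0// ltW.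
Qed.

(** [K] is the minimum of the quotient [F] of the two sides over the compact set [Z]; it exceeds 1
    because [Z] avoids the diagonal. If [Z] is empty, 2 will do. *)
Lemma strictly_power_concave_gap t (i : 'I_n) (d r : R) : 0 < t < 1 -> 0 < d ->
  exists2 K, 1 < K & forall x y, `|x| <= r -> `|y| <= r ->
    d <= `|y 0 i - x 0 i| ->
    K * pmean p%:E (f x) (f y) t <= f ((1 - t) *: x + t *: y).
Proof.
move=> t01 d0; have f0 := strictly_power_concave_gt0.
have t01' : 0 <= t <= 1 by case/andP: t01 => *; rewrite !ltW.
pose B : set 'rV[R]_n := [set x | `|x| <= r].
pose Z := (B `*` B) `&` [set xy : 'rV[R]_n * 'rV[R]_n | d <= `|xy.2 0 i - xy.1 0 i|].
pose F (xy : 'rV[R]_n * 'rV[R]_n) := f ((1 - t) *: xy.1 + t *: xy.2) /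
  pmean p%:E (f xy.1) (f xy.2) t.
have cf := strictly_power_concave_continuous.
have pm0 x y : 0 < pmean p%:E (f x) (f y) t by exact: pmean_gt0.
have cf1 : continuous (fun xy : 'rV[R]_n * 'rV[R]_n => f xy.1).
  move=> xy; apply: (@continuous_comp _ _ _ fst f); last exact: cf.
  exact: cvg_fst.
have cf2 : continuous (fun xy : 'rV[R]_n * 'rV[R]_n => f xy.2).
  move=> xy; apply: (@continuous_comp _ _ _ snd f); last exact: cf.
  exact: cvg_snd.
have cp1 r' : continuous (fun xy : 'rV[R]_n * 'rV[R]_n => f xy.1 `^ r').
  by move=> xy; apply: continuous_powR_comp => //; exact: cf1.
have cp2 r' : continuous (fun xy : 'rV[R]_n * 'rV[R]_n => f xy.2 `^ r').
  by move=> xy; apply: continuous_powR_comp => //; exact: cf2.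
have cF : continuous F.
  move=> xy; apply: cvgM.
    apply: (@continuous_comp _ _ _ (fun xy : 'rV[R]_n * 'rV[R]_n =>
      (1 - t) *: xy.1 + t *: xy.2) f); last exact: cf.
    apply: cvgD; apply: cvgZ; try exact: cvg_cst.
      exact: cvg_fst.
    exact: cvg_snd.
  apply: cvgV; first by rewrite gt_eqF.
  rewrite (_ : (fun _ => _) = (fun xy : 'rV[R]_n * 'rV[R]_n =>
      if p == 0 then f xy.1 `^ (1 - t) * f xy.2 `^ t
      else ((1 - t) * f xy.1 `^ p + t * f xy.2 `^ p) `^ p^-1)); last first.
    by apply/funext => v; rewrite pmean_pos.
  rewrite pmean_pos//; case: (eqVneq p 0) => _.
    by apply: cvgM; [exact: cp1|exact: cp2].
  apply: (@continuous_powR_comp _ _ (fun xy : 'rV[R]_n * 'rV[R]_n =>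
    (1 - t) * f xy.1 `^ p + t * f xy.2 `^ p)); last by rewrite wsum_gt0// powR_gt0.
  apply: cvgD; apply: cvgM; try exact: cvg_cst.
    exact: cp1.
  exact: cp2.
have cB : compact B.
  apply: bounded_closed_compact.
    exists r; split; [exact: num_real|move=> M rM x /= xr].
    by rewrite (le_trans xr)// ltW.
  apply: (@preimage_closed _ _ (fun x : 'rV[R]_n => `|x|) [set v | v <= r]).
    by move=> x _; exact: norm_continuous.
  exact: closed_le.
have cZ : compact Z.
  apply: compact_closedI; first exact: compact_setX.
  apply: (@preimage_closed _ _ (fun xy : 'rV[R]_n * 'rV[R]_n =>
    `|xy.2 0 i - xy.1 0 i|) [set v | d <= v]); last exact: closed_ge.
  move=> xy _; apply: cvg_norm; apply: cvgB.
    apply: (@continuous_comp _ _ _ snd (fun x : 'rV[R]_n => x 0 i)).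
      exact: cvg_snd.
    exact: coord_continuous.
  apply: (@continuous_comp _ _ _ fst (fun x : 'rV[R]_n => x 0 i)).
    exact: cvg_fst.
  exact: coord_continuous.
have [Z0|Z0] := pselect (Z !=set0); last first.
  by exists 2; [rewrite ltr1n|move=> x y xr yr xyd; case: Z0; exists (x, y)].
have [c + cmin] := compact_EVT_min Z0 cZ (continuous_subspaceT cF).
rewrite inE => -[_ /= cd]; exists (F c); last first.
  move=> x y xr yr xyd.
  have := cmin (x, y); rewrite inE => /(_ (conj (conj xr yr) xyd)).
  by rewrite [F (x, y)]/F/= ler_pdivlMr.
rewrite /F ltr_pdivlMr// mul1r; apply: strictly_power_concave_lt => // e.
by move: cd; rewrite e subrr normr0 leNgt d0.
Qed.

End strict.

End strictly_concave_functions.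

(** * Convex supports and their boundaries *)

Section support.
Context {R : realType} {n : nat}.
Implicit Types (x y z : 'rV[R]_n) (A : set 'rV[R]_n).
Local Notation mu := (lebesgue_measure_rV R n).

Lemma pmean0_le_nneg (q : \bar R) (c d t : R) : (0 <= q)%E -> 0 < c -> 0 < d ->
  0 <= t <= 1 -> pmean 0%:E c d t <= pmean q c d t.
Proof.
case: q => [q| |//] q0 c0 d0 t01; last first.
  rewrite [leRHS]pmean_pos//; set m := Num.max c d.
  have m0 : 0 < m by rewrite lt_max c0.
  rewrite -[leRHS](pmean_id 0%:E m0 t01).
  by apply: le_pmean => //; rewrite le_max lexx ?orbT.
move: q0; rewrite lee_fin le_eqVlt => /predU1P[<-//|q0].
exact: pmean0_le.
Qed.

(** For [q >= 0] the mean of exponent [q] dominates the geometric mean, so one convex function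
    serves for every [q], including [+oo]. *)
Lemma power_concave_support (g : 'rV[R]_n -> R) (q : \bar R) : (0 <= q)%E ->
  power_concave q g -> convex_on (~` (g @^-1` [set 0])) (fun y => - ln (g y)).
Proof.
move=> q0 [g0 gc] x y t /= /eqP gx /eqP gy t01.
have {}gx : 0 < g x by rewrite lt_neqAle eq_sym gx g0.
have {}gy : 0 < g y by rewrite lt_neqAle eq_sym gy g0.
have := gc x y t t01; rewrite -pmeanE.
move=> /(le_trans (pmean0_le_nneg q0 gx gy t01)).
have := pmean_gt0 0%:E gx gy t01; rewrite pmean_pos// eqxx => m0 mg.
have gz := lt_le_trans m0 mg; split; first by apply/eqP; rewrite gt_eqF.
move: mg; rewrite -ler_ln ?posrE// lnM ?posrE ?powR_gt0// !ln_powR; lra.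
Qed.

(** [A] lies in the dilation of its interior by any [c > 1], so its measure is at most [c ^+ n]
    times that of the interior; both are finite and [c] is arbitrarily close to 1. *)
Lemma null_convex_boundary A phi : convex_on A phi -> bounded_set A ->
  interior A !=set0 -> measurable (A : set (lebesgue_rV R n)) ->
  mu (A `\` interior A) = 0.
Proof.
move=> cA bA [x Ax] mA.
have mI : measurable (interior A : set (lebesgue_rV R n)).
  by apply: open_lebesgue_measurable; exact: open_interior.
have IA : interior A `<=` A by exact: interior_subset.
have Afin : (mu A < +oo)%E by exact: bounded_lebesgue_outer.
have Ifin : (mu (interior A) < +oo)%E.
  by apply: le_lt_trans Afin; exact: le_outer_measure.
have dil (c : R) : 1 < c -> (mu A <= (c ^+ n)%:E * mu (interior A))%E.
  move=> c1; have c0 : 0 < c by exact: lt_trans c1.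
  apply: le_trans (lebesgue_outer_affine ((1 - c) *: x) (interior A) c0).
  by apply: le_outer_measure; exact: convex_interior_dilation cA Ax c1.
have [a aE] : exists a : R, mu A = a%:E.
  by exists (fine (mu A)); rewrite fineK// ge0_fin_numE// measure_ge0.
have [b bE] : exists b : R, mu (interior A) = b%:E.
  by exists (fine (mu (interior A))); rewrite fineK// ge0_fin_numE// measure_ge0.
have b0 : 0 <= b by rewrite -lee_fin -bE measure_ge0.
have ab : a <= b.
  rewrite leNgt; apply/negP => ba.
  have {}dil (c : R) : 1 < c -> a <= c ^+ n * b.
    by move=> /dil; rewrite [in X in X -> _]aE [in X in X -> _]bE lee_fin.
  have {b0} [b0|b0] := eqVneq b 0.
    by have := dil 2; rewrite b0 mulr0 ltr1n => /(_ isT); lra.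
  have {}b0 : 0 < b.
    by rewrite lt_neqAle eq_sym b0 -lee_fin -bE measure_ge0.
  pose r := a / b; have r1 : 1 < r by rewrite ltr_pdivlMr// mul1r.
  (* The root of order [n.+1] makes [c ^+ n] strictly smaller than the ratio [r] of the two
     measures. *)
  pose c := r `^ n.+1%:R^-1.
  have cn : c ^+ n.+1 = r.
    rewrite /c -powR_mulrn ?powR_ge0// -powRrM mulVf ?pnatr_eq0// powRr1//.
    by rewrite ltW// (lt_trans _ r1).
  have c1 : 1 < c.
    rewrite -(@expr_gt1 _ n.+1) ?cn//.
    by rewrite powR_ge0.
  have := dil _ c1; have rE : a = r * b by rewrite divfK ?gt_eqF.
  rewrite [X in X <= _]rE ler_pM2r// -cn exprS ger_pMl ?exprn_gt0//; lra.
rewrite [LHS]measureD// setIidr//.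
rewrite [X in (X - _)%E]aE [X in (_ - X)%E]bE -EFinB; congr (_%:E).
apply/eqP; rewrite eq_le subr_le0 ab/= subr_ge0 -lee_fin -aE -bE.
exact: le_outer_measure.
Qed.

End support.

Lemma harmonic_exponent_fin (R : realType) (n : nat) (p : R) (q : \bar R) :
  p <= 0 -> q != -oo%E -> (0%:E <= p%:E + q)%E ->
  ((- n%:R^-1)%:E <= harmonic_exponent p q)%E ->
  exists l : R, [/\ harmonic_exponent p q = l%:E, l <= 0 & - n%:R^-1 <= l].
Proof.
move=> p0; case: q => [q| |//] _ /=; last by move=> _; exists p; split.
rewrite -EFinD lee_fin; case: (eqVneq (p + q) 0) => [pq _|pq pq0].
  by case: ifP => // _; rewrite lee_fin => h; exists 0; split.
rewrite lee_fin => h; exists (p * q / (p + q)); split => //.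
have {pq pq0} pq0 : 0 < p + q by rewrite lt_neqAle eq_sym pq.
by rewrite pmulr_lle0 ?invr_gt0// mulr_le0_ge0//; lra.
Qed.

(** * Concavity of the convolution *)

Section convolution_concavity.
Context {R : realType} {n : nat}.
Variables (f g : 'rV[R]_n -> R) (p : R) (q : \bar R) (l : R).
Hypotheses (n_gt0 : (0 < n)%N) (f_ge0 : forall x, 0 <= f x)
  (g_ge0 : forall x, 0 <= g x) (g_meas : lebesgue_measurable_fun g)
  (q_neqNy : q != -oo%E) (f_concave : strictly_power_concave p%:E f)
  (g_concave : power_concave q g)
  (g_bounded : bounded_set (~` (g @^-1` [set 0])))
  (g_interior : interior (~` (g @^-1` [set 0])) !=set0)
  (pq_ge0 : (0%:E <= p%:E + q)%E)
  (lE : harmonic_exponent p q = l%:E) (l_le0 : l <= 0) (l_ge : - n%:R^-1 <= l).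
Implicit Types (x y z : 'rV[R]_n) (t : R).
Local Notation mu := (lebesgue_measure_rV R n).

Let K : set 'rV[R]_n := ~` (g @^-1` [set 0]).
(** [u x] is known to be continuous only here, and the rest of [K] is null. *)
Let O := interior K.
Let u x y := f (x - y) * g y.

Let f_gt0 x : 0 < f x. Proof. exact: strictly_power_concave_gt0 f_concave x. Qed.

Let f_cont : continuous f.
Proof. exact: strictly_power_concave_continuous f_concave. Qed.

Let p_le0 : p <= 0.
Proof. exact: strictly_power_concave_exponent_le0 f_concave. Qed.

Let q_ge0 : (0 <= q)%E.
Proof.
have p0 := p_le0; case: q q_neqNy pq_ge0 => [s| |]// _.
by rewrite -EFinD !lee_fin => ps; lra.
Qed.

Let ln_convex : convex_on K (fun y => - ln (g y)).
Proof. exact: power_concave_support q_ge0 g_concave. Qed.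

Let K_gt0 y : K y -> 0 < g y.
Proof. by move=> /eqP gy; rewrite lt_neqAle eq_sym gy g_ge0. Qed.

Let O_open : open O. Proof. exact: open_interior. Qed.

Let OK : O `<=` K. Proof. exact: interior_subset. Qed.

Let O_bounded : bounded_set O.
Proof.
have [M [Mr KM]] := g_bounded; exists M; split => // N MN x Ox.
by apply: (KM N MN); exact: OK.
Qed.

Let K_measurable : measurable (K : set (lebesgue_rV R n)).
Proof.
apply: measurableC; rewrite -[X in measurable X]setTI; exact: g_meas.
Qed.

Let O_measurable : measurable (O : set (lebesgue_rV R n)).
Proof. exact: open_lebesgue_measurable. Qed.

Let u_ge0 x y : 0 <= u x y.
Proof. by rewrite /u mulr_ge0. Qed.

Let u_gt0 x y : K y -> 0 < u x y.
Proof. by move=> Ky; rewrite /u mulr_gt0// K_gt0. Qed.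

Let f_sub_cont x : continuous (fun y => f (x - y)).
Proof.
move=> y; apply: (@continuous_comp _ _ _ (fun y => x - y) f); last exact: f_cont.
by apply: (@cvgB _ _ _ _ (nbhs_filter y)); [exact: cvg_cst|exact: cvg_id].
Qed.

Let u_meas x : lebesgue_measurable_fun (u x).
Proof.
apply: measurable_funM; last exact: g_meas.
exact: (continuous_lebesgue_measurable (@f_sub_cont x)).
Qed.

Let u_cont x y : O y -> {for y, continuous (u x)}.
Proof.
move=> Oy; apply: (@cvgM _ _ _ (nbhs_filter y) (fun z => f (x - z)) g).
  exact: f_sub_cont.
have gc : {for y, continuous (fun y => - ln (g y))}.
  exact: convex_on_continuous ln_convex Oy.
have : {for y, continuous (fun z => expR (- - ln (g z)))}.
  apply: (@continuous_comp _ _ _ (fun z => - - ln (g z)) expR).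
    by move: gc => /cvgN.
  exact: continuous_expR.
have -> : g y = expR (- - ln (g y)) by rewrite opprK lnK// posrE K_gt0//; exact: OK.
apply: cvg_trans; apply: near_eq_cvg.
have : nbhs y O by exact: open_nbhs_nbhs.
apply: filterS => z Oz /=; rewrite opprK lnK// posrE K_gt0//; exact: OK.
Qed.

Let g_ub : exists C, forall y, g y <= C.
Proof.
have [c cP] := convex_on_bounded_below ln_convex g_bounded g_interior.
exists (expR (- c)) => y; have [Ky|nKy] := pselect (K y).
  by rewrite -[leLHS]lnK ?posrE ?K_gt0// ler_expR lerNr; exact: cP.
have -> : g y = 0 by exact: contrapT nKy.
exact: expR_ge0.
Qed.

Let u_ub x : exists C, forall y, K y -> u x y <= C.
Proof.
have [C gC] := g_ub; have [M [_ /(_ (M + 1)) KM]] := g_bounded.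
have {}KM y : K y -> `|y| <= M + 1 by apply: KM; rewrite ltrDl.
pose B : set 'rV[R]_n := [set y | `|y| <= M + 1].
have cB : compact B.
  apply: bounded_closed_compact.
    exists (M + 1); split; [exact: num_real|move=> r Mr y /= yM].
    by rewrite (le_trans yM)// ltW.
  apply: (@preimage_closed _ _ (fun x : 'rV[R]_n => `|x|) [set v | v <= M + 1]).
    by move=> y _; exact: norm_continuous.
  exact: closed_le.
have B0 : B !=set0 by have [y /OK Ky] := g_interior; exists y; exact: KM.
have [c _ cmax] := compact_EVT_max B0 cB (continuous_subspaceT (@f_sub_cont x)).
exists (f (x - c) * C) => y Ky; rewrite /u ler_pM//.
by apply: (cmax y); rewrite inE; exact: KM.
Qed.

Let integral_u_O x :
  (\int[mu]_y (u x y)%:E = \int[mu]_(y in O) (u x y)%:E)%E.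
Proof.
have mE (D : set (lebesgue_rV R n)) : measurable_fun D (fun y => (u x y)%:E).
  exact/measurable_EFinP/measurable_funTS/u_meas.
have uE (D : set (lebesgue_rV R n)) y : D y -> (0 <= (u x y)%:E)%E.
  by rewrite lee_fin.
have null := null_convex_boundary ln_convex g_bounded g_interior K_measurable.
transitivity (\int[mu]_(y in K) (u x y)%:E)%E.
  rewrite [RHS]integral_mkcond; apply: eq_integral => y _; rewrite patchE.
  case: ifPn => //; rewrite notin_setE => /contrapT gy.
  by rewrite /u (gy : g y = 0) mulr0.
rewrite (ge0_negligible_integral (measurableD K_measurable O_measurable)
  K_measurable (mE _) (@uE _) null).
by rewrite setDD setIidr.
Qed.

(** A single box on which [u x] exceeds half its value at [y0]; it shows that [u x] has positive
    mass on every nonempty open subset of [O]. *)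
Let step_below x (W : set 'rV[R]_n) y0 : open W -> W `<=` O -> W y0 ->
  exists s, [/\ step_wf s, forall k y, k \in s -> box k.1 y -> W y /\ k.2 <= u x y &
    0 < step_mass s].
Proof.
move=> oW WO Wy0; have Ky0 : K y0 by exact/OK/WO.
have /nbhs_rVP[e e0 eP] : nbhs y0 (W `&` [set y | u x y0 / 2 <= u x y]).
  apply: filterI; first exact: open_nbhs_nbhs.
  have u2 : u x y0 / 2 < u x y0 by rewrite ltr_pdivrMr// ltr_pMr ?ltr1n// u_gt0.
  near=> y; apply: ltW; near: y; exact: (cvgr_gt _ (u_cont (WO _ Wy0))).
pose b : 'rV[R]_n * 'rV[R]_n := (y0 - const_mx (e / 2), y0).
have bn : nondegenerate b.
  by apply/forallP => i; rewrite /b/= !mxE gtrBl divr_gt0.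
exists [:: (b, u x y0 / 2)]; split.
- by rewrite /step_wf/= bn divr_gt0// u_gt0.
- move=> k y; rewrite inE => /eqP-> yb; apply: eP => i.
  have := yb i; rewrite !mxE ltr_norml => /andP[h1 h2]; lra.
- by rewrite /step_mass big_seq1 mulr_gt0 ?box_volume_gt0// divr_gt0// u_gt0.
Unshelve. all: by end_near. Qed.

Let integral_u_fin x : exists2 U : R, 0 < U &
  (\int[mu]_(y in O) (u x y)%:E = U%:E)%E.
Proof.
have [C uC] := u_ub x; have [y0 Oy0] := g_interior.
have [s [sw sO s0]] := step_below x O_open (@subset_refl _ O) Oy0.
have lb := step_mass_le_integral (@u_ge0 x) (u_meas x) O_measurable sw sO.
have ub : (\int[mu]_(y in O) (u x y)%:E < +oo)%E.
  apply: (@le_lt_trans _ _ (\int[mu]_(y in O) (cst C%:E y))%E).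
    apply: ge0_le_integral.
    - exact: O_measurable.
    - by move=> y _; rewrite lee_fin.
    - exact/measurable_EFinP/measurable_funTS/u_meas.
    - exact: measurable_cst.
    - by move=> y Oy; rewrite lee_fin; apply: uC; exact: OK.
  rewrite integral_cst; last exact: O_measurable.
  have C0 : 0 <= C by apply: le_trans (uC y0 (OK Oy0)).
  have : (mu O < +oo)%E by exact: bounded_lebesgue_outer.
  move=> muO; rewrite lte_mul_pinfty ?lee_fin//.
have pos : (0 <= \int[mu]_(y in O) (u x y)%:E)%E.
  by apply: integral_ge0 => y _; rewrite lee_fin.
exists (fine (\int[mu]_(y in O) (u x y)%:E)%E).
  rewrite fine_gt0// ub andbT; apply: lt_le_trans lb.
  by rewrite lte_fin.
by rewrite fineK// ge0_fin_numE.
Qed.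

(** The real-valued integral in [convolution] would send [+oo] to 0, so finiteness comes first:
    [u x] is bounded on the bounded set [K]. *)
Lemma convolutionE x : (\int[mu]_(y in O) (u x y)%:E = (convolution f g x)%:E)%E.
Proof.
have [U U0 UE] := integral_u_fin x.
by rewrite /convolution /Rintegral integral_u_O UE.
Qed.

Lemma convolution_gt0 x : 0 < convolution f g x.
Proof.
by have [U U0 UE] := integral_u_fin x; rewrite -lte_fin -convolutionE UE.
Qed.

(** Applied with [k = 1] everywhere and with the gap factor at the left end of the support. *)
Let pointwise x0 x1 y0 y1 t (k : R) : 0 <= t <= 1 -> O y0 -> O y1 -> 0 <= k ->
  k * pmean p%:E (f (x0 - y0)) (f (x1 - y1)) t <=
    f ((1 - t) *: (x0 - y0) + t *: (x1 - y1)) ->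
  k * pmean l%:E (u x0 y0) (u x1 y1) t <=
  u ((1 - t) *: x0 + t *: x1) ((1 - t) *: y0 + t *: y1).
Proof.
move=> t01 /OK Ky0 /OK Ky1 k0 fk; have [g0 g1] := (K_gt0 Ky0, K_gt0 Ky1).
have H := pmean_harmonic p_le0 q_neqNy pq_ge0 lE (f_gt0 (x0 - y0))
  (f_gt0 (x1 - y1)) g0 g1 t01.
apply: le_trans (ler_wpM2l k0 H) _; rewrite mulrA /u.
have -> : (1 - t) *: x0 + t *: x1 - ((1 - t) *: y0 + t *: y1) =
    (1 - t) *: (x0 - y0) + t *: (x1 - y1).
  by apply/rowP => i; rewrite !mxE; ring.
apply: ler_pM => //.
- by rewrite mulr_ge0// ltW// pmean_gt0.
- by rewrite ltW// pmean_gt0.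
- by rewrite pmeanE; have [_] := g_concave; apply.
Qed.

Let mass_le x s : step_wf s ->
  (forall k y, k \in s -> box k.1 y -> O y /\ k.2 <= u x y) ->
  step_mass s <= convolution f g x.
Proof.
move=> sw sO; rewrite -lee_fin -convolutionE.
exact: step_mass_le_integral.
Qed.

(** [A] is the integral of [u x] over the part of [O] left of [e0]. A step function below [u x] has
    at most the remaining mass on the right, which bounds its left part uniformly over all such step
    functions. *)
Let left_mass x (i : 'I_n) (e0 : R) y0 : O y0 -> y0 0 i < e0 ->
  exists2 A : R, 0 < A & forall s, step_wf s ->
    (forall k y, k \in s -> box k.1 y -> O y /\ k.2 <= u x y) ->
    step_mass s - (convolution f g x - A) <=
    step_mass (step_cut (box_cutl i e0) s).
Proof.
move=> Oy0 y0e; have u0 := @u_ge0 x.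
pose W := O `&` [set y | y 0 i < e0].
have oW : open W.
  apply: openI; first exact: O_open.
  apply: (@open_comp _ _ (fun y : 'rV[R]_n => y 0 i) [set v | v < e0]).
    by move=> y _; exact: coord_continuous.
  exact: open_lt.
have [s [sw sW s0]] := step_below x oW (@subIsetl _ _ _) (conj Oy0 y0e).
have UE := integral_halfspace i e0 u0 (u_meas x) O_measurable.
have mH := measurable_halfspace (R := R) i e0.
have mOH : measurable (O `&` [set y | y 0 i <= e0] : set (lebesgue_rV R n)).
  exact: measurableI.
have mOH' : measurable (O `&` ~` [set y | y 0 i <= e0] : set (lebesgue_rV R n)).
  exact/measurableI/measurableC.
have lb : ((step_mass s)%:E <=
    \int[mu]_(y in O `&` [set y | (y 0 i <= e0)%R]) (u x y)%:E)%E.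
  apply: step_mass_le_integral => // k y ks ky.
  by have [[Oy /ltW ye] kuy] := sW k y ks ky.
rewrite convolutionE in UE.
have pos : (0 <= \int[mu]_(y in O `&` ~` [set y | (y 0 i <= e0)%R]) (u x y)%:E)%E.
  by apply: integral_ge0 => y _; rewrite lee_fin.
have [A AE] : exists A : R,
    (\int[mu]_(y in O `&` [set y | (y 0 i <= e0)%R]) (u x y)%:E = A%:E)%E.
  exists (fine (\int[mu]_(y in O `&` [set y | (y 0 i <= e0)%R]) (u x y)%:E)).
  rewrite fineK// ge0_fin_numE; last by rewrite (le_trans _ lb)// lee_fin ltW.
  by apply: (@le_lt_trans _ _ (convolution f g x)%:E); rewrite ?ltry// UE leeDl.
rewrite AE in UE lb; exists A.
  by rewrite -lte_fin (lt_le_trans _ lb)// lte_fin.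
move=> s' sw' sO'.
have : ((step_mass (step_cut (box_cutr i e0) s'))%:E <=
    (convolution f g x - A)%:E)%E.
  rewrite EFinB UE addeAC subee// add0e.
  apply: step_mass_le_integral => //.
    by apply: step_wf_cut => //; exact: separated_cutr.
  move=> k y; rewrite mem_filter => /andP[_ /mapP[k' ks' ->]].
  rewrite box_cutrE => -[ky ye]; have [Oy kuy] := sO' _ _ ks' ky.
  by split => //; split => //=; apply/negP; rewrite -ltNge.
by rewrite lee_fin; have := step_mass_cutD i e0 s'; lra.
Qed.

Lemma convolution_lt x0 x1 t : x0 <> x1 -> 0 < t < 1 ->
  pmean (convolution_exponent n l%:E) (convolution f g x0) (convolution f g x1) t
  < convolution f g ((1 - t) *: x0 + t *: x1).
Proof.
move=> x01 t01; have t01' : 0 <= t <= 1 by case/andP: t01 => *; rewrite !ltW.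
have /existsP[i xi] : [exists i, x0 0 i != x1 0 i].
  apply: contra_notT x01; rewrite negb_exists => /forallP h; apply/rowP => i.
  by apply/eqP; have := h i; rewrite negbK.
(* Points [y], [z] of [O] within [d] of the left end differ by at most [d] in coordinate [i], half
   of what separates [x0] and [x1]; so [x0 - y] and [x1 - z] still differ by at least [d]. *)
pose d := `|x1 0 i - x0 0 i| / 2.
have d0 : 0 < d by rewrite divr_gt0// normr_gt0 subr_eq0 eq_sym.
have [M [_ /(_ (M + 1)) OM]] := O_bounded.
have {}OM y : O y -> `|y| <= M + 1 by apply: OM; rewrite ltrDl.
pose E : set R := [set y 0 i | y in O].
have Einf : has_inf E.
  split; first by have [y Oy] := g_interior; exists (y 0 i), y.
  exists (- (M + 1)) => _ [y Oy <-].
  have := le_trans (coord_le_norm y i) (OM _ Oy); rewrite ler_norml.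
  by case/andP.
pose e0 := inf E + d.
have [_ [y0 Oy0 <-] y0e] := inf_adherent d0 Einf.
have Oinf y : O y -> inf E <= y 0 i.
  by move=> Oy; apply: ge_inf; [exact: Einf.2|exists y].
have [k k1 gap] := strictly_power_concave_gap n_gt0 f_concave i
  (Num.max `|x0| `|x1| + (M + 1)) t01 d0.
have [U0 U1] := (convolution_gt0 x0, convolution_gt0 x1).
have [A0 A00 left0] := left_mass x0 Oy0 y0e.
have [A1 A10 left1] := left_mass x1 Oy0 y0e.
have [V0E V1E] := (convolutionE x0, convolutionE x1).
have [mass0 mass1] := (@mass_le x0, @mass_le x1).
move: (convolution f g x0) (convolution f g x1)
  => V0 V1 in U0 U1 left0 left1 V0E V1E mass0 mass1 *.
(* The left end carries at least the proportion [2 * theta] of each mass; half of it is a reserve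
   for what the step functions miss. *)
pose theta := Num.min 1 (Num.min (A0 / V0) (A1 / V1)) / 2.
have min0 : 0 < Num.min 1 (Num.min (A0 / V0) (A1 / V1)).
  by rewrite !lt_min ltr01 !divr_gt0.
have th0 : 0 < theta by rewrite divr_gt0.
have th1 : theta < 1.
  by rewrite /theta ltr_pdivrMr// mul1r gt_min ltr1n.
have thE : 2 * theta = Num.min 1 (Num.min (A0 / V0) (A1 / V1)).
  by rewrite /theta mulrC divfK ?pnatr_eq0.
have thA0 : 2 * theta * V0 <= A0.
  by rewrite thE -ler_pdivlMr// !ge_min lexx orbT.
have thA1 : 2 * theta * V1 <= A1.
  by rewrite thE -ler_pdivlMr// !ge_min lexx !orbT.
pose w := 1 - theta + theta * k.
have w1 : 1 < w.
  have : 0 < theta * (k - 1) by rewrite mulr_gt0// subr_gt0.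
  by rewrite /w mulrBr mulr1; lra.
have w0 : 0 < w by exact: lt_trans w1.
(* The precision asked of the step functions: they miss at most the reserve [theta], and their loss
   does not eat up the gain [w]. *)
have [kappa [kappa1 kappath wkappa]] : exists kappa : R,
    [/\ kappa < 1, 1 - theta <= kappa & 1 < w * kappa].
  pose c := Num.max (1 - theta) w^-1; exists ((1 + c) / 2).
  have c1 : c < 1 by rewrite gt_max gtrBl th0 invf_lt1.
  have cth : 1 - theta <= c by rewrite le_max lexx.
  have cw : w^-1 <= c by rewrite le_max lexx orbT.
  split; [by lra|by lra|rewrite -ltr_pdivrMl// mulr1; lra].
have kappa0 : 0 < kappa by apply: lt_le_trans kappath; rewrite subr_gt0.
have ltV V : 0 < V -> kappa * V < V by move=> V0'; rewrite gtr_pMl.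
have [s [sw sO sV]] : exists s, [/\ step_wf s,
    forall k x, k \in s -> box k.1 x -> O x /\ k.2 <= u x0 x &
    kappa * V0 < step_mass s].
  apply: step_approximation => //; first exact: u_cont.
  by rewrite V0E lte_fin ltV.
have [s' [sw' sO' sV']] : exists s, [/\ step_wf s,
    forall k x, k \in s -> box k.1 x -> O x /\ k.2 <= u x1 x &
    kappa * V1 < step_mass s].
  apply: step_approximation => //; first exact: u_cont.
  by rewrite V1E lte_fin ltV.
have kV0 : 0 < kappa * V0 by rewrite mulr_gt0.
have kV1 : 0 < kappa * V1 by rewrite mulr_gt0.
(* Of a mass [m] above [(1 - theta) * V], at most [V - A <= (1 - 2 * theta) * V] lies on the right,
   which leaves [theta * V] on the left. *)
have left_half V A m c : 0 < V -> 2 * theta * V <= A -> kappa * V < m -> m <= V ->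
    m - (V - A) <= c -> theta * m <= c.
  move=> V0' VA Vm mV mc.
  have h1 : theta * m <= theta * V by rewrite ler_wpM2l// ltW.
  have h2 : (1 - theta) * V <= kappa * V by rewrite ler_wpM2r// ltW.
  by lra.
have ml := left_half _ _ _ _ U0 thA0 sV (mass0 _ sw sO) (left0 _ sw sO).
have ml' := left_half _ _ _ _ U1 thA1 sV' (mass1 _ sw' sO') (left1 _ sw' sO').
have k0 : 0 <= k by rewrite ltW// (lt_trans _ k1).
have th01 : 0 < theta < 1 by rewrite th0.
pose xt := (1 - t) *: x0 + t *: x1.
have gain :
  ((w * pmean (convolution_exponent n l%:E) (step_mass s) (step_mass s') t)%:E <= \int[mu]_y (u xt y)%:E)%E.
  apply: (@step_borell_brascamp_lieb_gain R n t t01 (fun a b => pmean l%:E a b t)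
    (fun a b => pmean (convolution_exponent n l%:E) a b t) (u xt) k theta i e0 s s')
    => //.
  - by move=> a b a0 b0; rewrite ltW// pmean_gt0.
  - by move=> a b v v' a0 b0 v0 v'0; exact: pmean_box.
  - by move=> c a b c0 a0 b0; exact: pmeanZ.
  - by rewrite -step_mass_gt0// (lt_trans _ sV).
  - by rewrite -step_mass_gt0// (lt_trans _ sV').
  move=> kk ll y z ks ls ky lz.
  have [[Oy ku] [Oz lu]] := (sO _ _ ks ky, sO' _ _ ls lz).
  have [kk0 ll0] : 0 < kk.2 /\ 0 < ll.2.
    by split; [have /andP[/allP/(_ _ ks)/andP[]] := sw|
      have /andP[/allP/(_ _ ls)/andP[]] := sw'].
  have mm := le_pmean l%:E kk0 ll0 ku lu t01'.
  split.
    apply: le_trans mm _; have := @pointwise x0 x1 y z t 1 t01' Oy Oz ler01.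
    by rewrite !mul1r; apply; exact: strictly_power_concave_le.
  move=> ye ze; apply: le_trans (ler_wpM2l k0 mm) _.
  apply: pointwise => //; apply: gap.
  - rewrite (le_trans (ler_normB _ _))// lerD// ?OM//.
    by rewrite le_max lexx.
  - rewrite (le_trans (ler_normB _ _))// lerD// ?OM//.
    by rewrite le_max lexx orbT.
  have [iy iz] := (Oinf _ Oy, Oinf _ Oz).
  have -> : (x1 - z) 0 i - (x0 - y) 0 i = (x1 0 i - x0 0 i) - (z 0 i - y 0 i).
    by rewrite !mxE; ring.
  apply: le_trans (lerB_dist _ _); rewrite lerBrDr.
  have zy : `|z 0 i - y 0 i| <= d by rewrite ler_norml /e0 in ye ze *; lra.
  apply: le_trans (lerD (lexx d) zy) _; rewrite /d; lra.
rewrite integral_u_O convolutionE lee_fin in gain.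
apply: lt_le_trans gain.
have : kappa * pmean (convolution_exponent n l%:E) V0 V1 t <=
    pmean (convolution_exponent n l%:E) (step_mass s) (step_mass s') t.
  by rewrite -pmeanZ//; apply: le_pmean => //; exact: ltW.
move=> /(ler_wpM2l (ltW w0)); apply: lt_le_trans.
by rewrite mulrA ltr_pMl// pmean_gt0.
Qed.

End convolution_concavity.

Theorem theorem3p9 (R : realType) (n : nat) (n_gt0 : (0 < n)%N)
    (f g : 'rV[R]_n -> R)
    (f_ge0 : forall x, 0 <= f x) (g_ge0 : forall x, 0 <= g x)
    (f_meas : lebesgue_measurable_fun f) (g_meas : lebesgue_measurable_fun g)
    (p : R) (q : \bar R) (q_neqNy : q != -oo%E)
    (f_concave : strictly_power_concave p%:E f)
    (g_concave : power_concave q g)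
    (g_bounded : bounded_set (~` (g @^-1` [set 0])))
    (g_interior : interior (~` (g @^-1` [set 0])) !=set0)
    (pq_ge0 : (0%:E <= p%:E + q)%E)
    (l_ge : ((- n%:R^-1)%:E <= harmonic_exponent p q)%E) :
  strictly_power_concave (convolution_exponent n (harmonic_exponent p q))
    (convolution f g).
Proof.
have p_le0 := strictly_power_concave_exponent_le0 n_gt0 f_concave.
have [l [lE l_le0 l_ge']] := harmonic_exponent_fin p_le0 q_neqNy pq_ge0 l_ge.
have G0 := convolution_gt0 n_gt0 f_ge0 g_ge0 g_meas q_neqNy f_concave g_concave
  g_bounded g_interior pq_ge0.
have Glt := convolution_lt n_gt0 f_ge0 g_ge0 g_meas q_neqNy f_concave g_concave
  g_bounded g_interior pq_ge0 lE l_le0 l_ge'.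
rewrite lE; set e := convolution_exponent n l%:E in Glt *.
(* Since [l] is finite, the value [+oo] is excluded. *)
have eNy : e = -oo%E \/ exists r, e = r%:E.
  rewrite /e /convolution_exponent; case: ifP => _; first by left.
  by right; eexists.
have at0 x0 x1 : (1 - 0) *: x0 + 0 *: x1 = x0 :> 'rV[R]_n.
  by rewrite subr0 scale1r scale0r addr0.
have at1 x0 x1 : (1 - 1) *: x0 + 1 *: x1 = x1 :> 'rV[R]_n.
  by rewrite subrr scale1r scale0r add0r.
have atid x (t : R) : (1 - t) *: x + t *: x = x :> 'rV[R]_n.
  by rewrite -scalerDl subrK scale1r.
have trichotomy x0 x1 (t : R) : 0 <= t <= 1 ->
    [\/ x0 = x1 :> 'rV[R]_n, t = 0, t = 1 | x0 <> x1 /\ 0 < t < 1].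
  move=> /andP[t0 t1]; have [->|/eqP x01] := eqVneq x0 x1; first by constructor 1.
  have [->|tn0] := eqVneq t 0; first by constructor 2.
  have [->|tn1] := eqVneq t 1; first by constructor 3.
  by constructor 4; split=> //; rewrite !lt_neqAle eq_sym tn0 t0 tn1.
split; first split.
- by move=> x; rewrite ltW.
- move=> x0 x1 t t01; rewrite -pmeanE.
  have [->|->|->|[x01 t01']] := trichotomy x0 x1 t t01.
  + by rewrite atid pmean_id.
  (* For the exponent [-oo] the mean at [t = 0] is still the minimum of both values, so only the
     inequality holds. *)
  + rewrite at0; case: eNy => [->|[r ->]]; last by rewrite pmean0.
    by rewrite pmean_pos// ge_min lexx.
  + rewrite at1; case: eNy => [->|[r ->]]; last by rewrite pmean1.
    by rewrite pmean_pos// ge_min lexx orbT.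
  + exact/ltW/Glt.
- move=> x0 x1 t t01 et; rewrite -pmeanE; split.
    have [->|->|->|[x01 t01']] := trichotomy x0 x1 t t01.
    + by constructor 1.
    + by constructor 2.
    + by constructor 3.
    + by move=> eq; have := Glt _ _ _ x01 t01'; rewrite eq ltxx.
  case=> [->|t0|t1].
  + by rewrite atid pmean_id.
  + case: et => [efin|]; last by rewrite t0 ltxx.
    by case: eNy efin => [->//|[r ->] _]; rewrite t0 at0 pmean0.
  + case: et => [efin|]; last by rewrite t1 ltxx andbF.
    by case: eNy efin => [->//|[r ->] _]; rewrite t1 at1 pmean1.
Qed.
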